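(* Let $n\ge 3$. If two simplices $\Delta$ and $\Delta'$ of the triangulation $\mathcal{T}_n^{\mathrm{LRL}}$ are adjacent, then their corresponding integer flows $\phi(\Delta)$ and $\phi(\Delta')$ in $\mathcal{F}_n^{\mathbb{Z}}$ are adjacent, that is, they differ by one of the elementary moves: there is some $i$ with $2\le i\le n-1$ such that $\phi(\Delta')=m_i^+(\phi(\Delta))$ or $\phi(\Delta')=m_i^-(\phi(\Delta))$ (the move being applicable).
   Context: The contracted zigzag graph $G_n$ (written $\widehat{\mathrm{Zig}}_n$) is the directed multigraph with vertices $1,\dots,n$ and edges $x_i=(i,i+1)$ for $1\le i\le n-1$ (slack edges), $y_0=(1,2)$, $y_i=(i,i+2)$ for $1\le i\le n-2$, and $y_{n-1}=(n-1,n)$ (nonslack edges). The inner vertices are $2,\dots,n-1$. Each inner vertex $i$ has incoming edges $\{x_{i-1},y_{i-2}\}$ and outgoing edges $\{x_i,y_i\}$. The length-reverse-length (LRL) framing orders them by $y_{i-2}\prec x_{i-1}$ (incoming) and $x_i\prec y_i$ (outgoing) at every inner vertex $i$. A route is a directed path from $1$ to $n$; a prefix at $i$ is a directed path from $1$ to $i$; a suffix at $i$ is a directed path from $i$ to $n$. Paths are sequences of edges (parallel edges are distinguished). For distinct prefixes $P,P'$ at an inner vertex $i$, let $j\le i$ be the vertex after which they coincide and which they enter along different edges $e$ (of $P$) and $e'$ (of $P'$); set $P\prec P'$ if $e\prec e'$ in the incoming order at $j$. For distinct suffixes $Q,Q'$ at $i$, let $k\ge i$ be the first vertex which they leave along different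 edges $e$ (of $Q$), $e'$ (of $Q'$); set $Q\prec Q'$ if $e\prec e'$ in the outgoing order at $k$. Two routes $R=PiQ$ and $R'=P'iQ'$ through a common inner vertex $i$ (with prefixes $P,P'$ and suffixes $Q,Q'$ at $i$) conflict at $i$ if the prefixes and suffixes are oppositely ordered ($P\prec P'$ and $Q'\prec Q$, or vice versa). A maximal clique is an inclusion-maximal set of routes no two of which conflict at any vertex. Each route is identified with its 0/1 indicator vector in $\mathbb{R}^{E(G_n)}$, a vertex of the flow polytope of nonnegative unit flows from $1$ to $n$. For a maximal clique $C$, $\Delta_C$ is the convex hull of its routes; the $\Delta_C$ are the maximal simplices of a regular unimodular triangulation of this flow polytope (Danilov–Karzanov–Koshevoy). $\mathcal{T}_n^{\mathrm{LRL}}$ denotes the set of these simplices. Two simplices are adjacent if they share a codimension 1 face, equivalently if their maximal cliques differ by exactly one route. $\mathcal{F}_n^{\mathbb{Z}}$ is the set of functions $\phi:E(G_n)\to\mathbb{Z}_{\ge0}$ with $\sum_{e\text{ into }i}\phi(e)+d_i=\sum_{e\text{ out of }i}\phi(e)$ for every vertex $i$, where $(d_1,\dots,d_n)=(0,1,1,\dots,1,-(n-2))$. There is a bijection (Mészáros–Morales–Striker) $\Delta_C\mapsto\phi(\Delta_C)$ from $\mathcal{T}_n^{\mathrm{LRL}}$ to $\mathcal{F}_n^{\mathbb{Z}}$: $\phi(\Delta_C)(e)=0$ if $e$ leaves vertex $1$, and if $e$ leaves an inner vertex $i$, then $\phi(\Delta_C)(e)$ is one less than the number of prefixes $P$ at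 $i$ such that some route of $C$ begins with $P$ followed by $e$. Elementary moves on $\mathcal{F}_n^{\mathbb{Z}}$, for $2\le i\le n-1$: if $\phi(x_i)>0$ and $\phi(y_{i+1})>0$, then $m_i^+(\phi)$ is the flow obtained by subtracting one from $\phi(x_i)$ and $\phi(y_{i+1})$ and adding one to $\phi(x_{i+2})$ and $\phi(y_i)$; otherwise $m_i^+$ does not apply. If $\phi(x_{i+2})>0$ and $\phi(y_i)>0$, then $m_i^-(\phi)$ is the flow obtained by subtracting one from $\phi(x_{i+2})$ and $\phi(y_i)$ and adding one to $\phi(x_i)$ and $\phi(y_{i+1})$; otherwise $m_i^-$ does not apply. When $i\in\{n-2,n-1\}$, all conditions and operations involving the nonexistent values $\phi(x_n),\phi(y_n),\phi(x_{n+1})$ are ignored. *)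

(* Defs.v *)
From HB Require Import structures.
From mathcomp Require Import all_boot all_order all_algebra.
From mathcomp Require Import boolp classical_sets reals.
Set Implicit Arguments.
Unset Strict Implicit.
Unset Printing Implicit Defensive.
Import Order.TTheory GRing.Theory Num.Theory.
Local Open Scope ring_scope.

(* Edges of the contracted zigzag graph G_n, whose vertices are the natural
   numbers 1, ..., n.  [inl a] is the slack edge x_(a+1), so that the slack
   edges are x_1, ..., x_(n-1); [inr a] is the nonslack edge y_a, with
   0 <= a <= n-1. *)
Notation edge n := ('I_n.-1 + 'I_n)%type.

Definition slack n (e : edge n) : bool := if e is inl _ then true else false.

Definition esrc n (e : edge n) : nat :=
  match e with
  | inl a => a.+1
  | inr a => if a == 0%N :> nat then 1%N else a
  end.

Definition etgt n (e : edge n) : nat :=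
  match e with
  | inl a => a.+2
  | inr a => if a == n.-1 :> nat then n else a.+2
  end.

Definition inner n (i : nat) : bool := (1 < i < n)%N.

Fixpoint walk n (u : nat) (p : seq (edge n)) (v : nat) : bool :=
  if p is e :: p' then (esrc e == u) && walk (etgt e) p' v else u == v.

Definition prefix_at n (i : nat) (P : seq (edge n)) : bool := walk 1%N P i.
Definition suffix_at n (i : nat) (Q : seq (edge n)) : bool := walk i Q n.
Definition is_route n (r : seq (edge n)) : bool := walk 1%N r n.

(* The length-reverse-length framing; used at inner vertices only. *)
Definition in_lt n (e f : edge n) : bool :=
  [&& etgt e == etgt f, ~~ slack e & slack f].
Definition out_lt n (e f : edge n) : bool :=
  [&& esrc e == esrc f, slack e & ~~ slack f].

Fixpoint first_diff_lt (T : eqType) (lt : rel T) (p q : seq T) : bool :=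
  match p, q with
  | e :: p', f :: q' => if e == f then first_diff_lt lt p' q' else lt e f
  | _, _ => false
  end.

(* Prefixes are compared at their last divergence, hence the reversal. *)
Definition prefix_lt n (P P' : seq (edge n)) : bool :=
  first_diff_lt (@in_lt n) (rev P) (rev P').
Definition suffix_lt n (Q Q' : seq (edge n)) : bool :=
  first_diff_lt (@out_lt n) Q Q'.

Definition conflict_at n (i : nat) (r r' : seq (edge n)) : Prop :=
  inner n i /\
  exists P Q P' Q' : seq (edge n),
    [/\ r = P ++ Q, r' = P' ++ Q',
        prefix_at i P && suffix_at i Q, prefix_at i P' && suffix_at i Q'
      & (prefix_lt P P' && suffix_lt Q' Q) || (prefix_lt P' P && suffix_lt Q Q')].

(* A directed path of G_n has fewer than n edges, so the finite type of edge
   sequences of length at most n contains all of them. *)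
Notation edge_seq n := (n.-bseq (edge n)).

Definition clique n (C : {set edge_seq n}) : Prop :=
  (forall r, r \in C -> is_route r) /\
  (forall r r' i, r \in C -> r' \in C -> ~ conflict_at i r r').

Definition maximal_clique n (C : {set edge_seq n}) : Prop :=
  clique C /\ forall D : {set edge_seq n}, clique D -> C \subset D -> D = C.

Definition indicator (R : realType) n (r : edge_seq n) : {ffun edge n -> R} :=
  [ffun e => (e \in r)%:R].

(* The convex hull of the indicator vectors of the elements of C. *)
Definition simplex (R : realType) n (C : {set edge_seq n}) :
    set {ffun edge n -> R} :=
  [set v : {ffun edge n -> R} | exists lam : edge_seq n -> R,
      [/\ forall r, r \in C -> 0 <= lam r,
          \sum_(r in C) lam r = 1
        & forall e, v e = \sum_(r in C) lam r * indicator R r e]]%classic.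
Arguments simplex R {n} C _.

(* For a maximal clique C the elements of C are the vertices of a simplex, so
   a codimension 1 face is the hull of all the vertices but one. *)
Definition codim1_face (R : realType) n (C : {set edge_seq n})
    (F : set {ffun edge n -> R}) : Prop :=
  exists2 r, r \in C & F = simplex R (C :\ r).

Definition adjacent (R : realType) n (C C' : {set edge_seq n}) : Prop :=
  simplex R C <> simplex R C' /\
  exists F : set {ffun edge n -> R}, codim1_face C F /\ codim1_face C' F.

Notation flow n := {ffun edge n -> int}.

Definition netflow (n i : nat) : int :=
  if i == 1%N then 0 else if i == n then - (n%:Z - 2) else 1.

Definition int_flow n (phi : flow n) : Prop :=
  (forall e, 0 <= phi e) /\
  (forall i : nat, (1 <= i <= n)%N ->
     \sum_(e | etgt e == i) phi e + netflow n i = \sum_(e | esrc e == i) phi e).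

Definition flow_of n (C : {set edge_seq n}) : flow n :=
  [ffun e : edge n =>
    if esrc e == 1%N then 0
    else #|[pred P : edge_seq n | prefix_at (esrc e) P &&
             [exists r in C, prefix (rcons P e) r]]|%:Z - 1].

(* [is_x k] and [is_y k] hold of the edge x_k, resp. y_k, and of no edge when
   G_n has none of that name.  Hence conditions and changes at nonexistent
   edges are void in what follows. *)
Definition is_x n (k : nat) (e : edge n) : bool :=
  if e is inl a then a.+1 == k else false.
Definition is_y n (k : nat) (e : edge n) : bool :=
  if e is inr a then a == k :> nat else false.

Definition positive_on n (phi : flow n) (p : pred (edge n)) : bool :=
  [forall e, p e ==> (0 < phi e)].

Definition move_plus n (i : nat) (phi : flow n) : option (flow n) :=
  if positive_on phi (is_x i) && positive_on phi (is_y i.+1) then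
    Some [ffun e => phi e - (is_x i e)%:Z - (is_y i.+1 e)%:Z
                          + (is_x i.+2 e)%:Z + (is_y i e)%:Z]
  else None.

Definition move_minus n (i : nat) (phi : flow n) : option (flow n) :=
  if positive_on phi (is_x i.+2) && positive_on phi (is_y i) then
    Some [ffun e => phi e - (is_x i.+2 e)%:Z - (is_y i e)%:Z
                          + (is_x i e)%:Z + (is_y i.+1 e)%:Z]
  else None.

Definition adjacent_flows n (phi phi' : flow n) : Prop :=
  exists2 i : nat, (2 <= i <= n.-1)%N &
    move_plus i phi = Some phi' \/ move_minus i phi = Some phi'.

(* Main.v *)
Require Import Defs.
From mathcomp Require Import all_boot all_order all_algebra.
From mathcomp Require Import boolp classical_sets reals.
From mathcomp Require Import zify.
Set Implicit Arguments.
Unset Strict Implicit.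
Unset Printing Implicit Defensive.

(** Let C = D + r and C' = D + r' be adjacent maximal cliques.  By maximality r
    and r' conflict; at the last vertex i where they do, up to exchanging C and
    C', r = P x_i B and r' = P' y_i B' with P' before P.  The exchanged routes
    P y_i B' and P' x_i B then lie in D.  In a maximal clique exactly one prefix
    at each inner vertex extends along both outgoing edges, so r is the only
    route of C starting with P x_i, and r' the only route of C' starting with
    P' y_i.  As P x_i is the last prefix of C at i+1 and P' y_i the first prefix
    of C' at i+2, B starts with y_(i+1) and B' with x_(i+2); after that both
    follow the first suffix of D behind a prefix entering i+3 through x_(i+2).
    Hence the flows differ exactly on x_i, y_(i+1), y_i, x_(i+2). *)

(** An order decided at a first difference depends on nothing beyond it. Hence, when two routes
    compatible with [t] are spliced at [i], any conflict of the result with [t] shows up at [i], and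
    compatibility reduces to one comparison there. Choosing the last conflict makes the suffixes of
    r and r' separate at [i] itself, and keeps the spliced routes free of conflicts with r and r'
    further on. The flows can be compared because r alone starts with P x_i: removing it costs each
    edge of x_i B exactly one prefix, and the edges of P none, since P still starts a route of D.
    The common ends of r and r' then cancel. Two points lie outside this argument. Adjacency is
    stated for convex hulls, so the common part D has to be recovered from a common face; a route is
    determined by its indicator. Conservation needs every inner vertex visited and every edge used,
    which maximality also forces. *)

Section FirstDiff.
Context (T : eqType) (lt : rel T).
Implicit Types p q z : seq T.

Lemma first_diff_cat z p q :
  first_diff_lt lt (z ++ p) (z ++ q) = first_diff_lt lt p q.
Proof. by elim: z => //= e z ->; rewrite eqxx. Qed.

Lemma first_diff_irr p : first_diff_lt lt p p = false.
Proof. by elim: p => //= e p ->; rewrite eqxx. Qed.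

(** The comparison is settled inside [p], whatever follows, unless [q] runs along all of [p]. This
    dichotomy transports conflicts between routes that share a segment. *)
Lemma first_diff_stable p q :
  (exists q', q = p ++ q') \/
  (forall z z', first_diff_lt lt (p ++ z) q = first_diff_lt lt (p ++ z') q /\
                first_diff_lt lt q (p ++ z) = first_diff_lt lt q (p ++ z')).
Proof.
elim: p q => [|e p IH] [|f q] /=; [by left; exists [::]|by left; exists (f :: q)|by right|].
have [->|nef] := eqVneq e f; last by right.
have [[q' ->]|H] := IH q; first by left; exists q'.
by right.
Qed.

Hypothesis lt_irr : irreflexive lt.
Hypothesis lt_tr : transitive lt.

Lemma first_diff_trans : transitive (first_diff_lt lt).
Proof.
move=> q p r; elim: q p r => [|e q IH] [|f p] [|g r] //=.
have [->|nfe] := eqVneq f e.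
  by have [_|_] := eqVneq e g; [apply: IH|].
move=> fe; have [<-|neg] := eqVneq e g; first by rewrite (negPf nfe).
move=> eg; have [efg|] := eqVneq f g; last by rewrite (lt_tr fe eg).
by have := lt_tr fe eg; rewrite efg lt_irr.
Qed.

End FirstDiff.

Lemma exists_extremal (T : eqType) (lt : rel T) (s : seq T) x0 :
  irreflexive lt -> transitive lt -> x0 \in s ->
  exists2 m, m \in s & forall x, x \in s -> ~~ lt m x.
Proof.
move=> irr tr; elim: s x0 => // a [|b s] IH x0 _.
  by exists a; rewrite ?mem_head // => x; rewrite inE => /eqP->; rewrite irr.
have [m ms mmax] := IH b (mem_head _ _).
have [ma|nma] := boolP (lt m a).
  exists a; rewrite ?mem_head // => x; rewrite inE => /predU1P[->|xs]; first by rewrite irr.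
  by apply/negP=> /(tr _ _ _ ma); apply/negP/mmax.
exists m; first by rewrite inE ms orbT.
by move=> x; rewrite inE => /predU1P[->|/mmax].
Qed.

(** * Paths of the contracted zigzag graph *)

Section Walks.
Context (n : nat) (n_gt2 : 2 < n).
Implicit Types (C : {set edge_seq n}) (e f : edge n) (p q P Q A B E : seq (edge n)) (i j u v w : nat).

Lemma esrc_gt0 e : 0 < esrc e.
Proof. by case: e => a //=; case: eqP => //=; lia. Qed.

Lemma esrc_lt_etgt e : esrc e < etgt e.
Proof. by case: e => a //=; have := ltn_ord a; case: eqP => /=; case: eqP => /=; lia. Qed.

Lemma etgt_le e : etgt e <= n.
Proof. by case: e => a //=; have := ltn_ord a; try case: eqP => /=; lia. Qed.

Lemma etgt_le2 e : etgt e <= (esrc e).+2.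
Proof. by case: e => a //=; have := ltn_ord a; try case: eqP => /=; try case: eqP => /=; lia. Qed.

Lemma etgt_slack e : slack e -> etgt e = (esrc e).+1.
Proof. by case: e => a. Qed.

Lemma etgt_nslack e : ~~ slack e -> 1 < esrc e -> etgt e = minn n (esrc e).+2.
Proof.
by case: e => a //= _; have := ltn_ord a; case: eqP => /=; case: eqP => /=; lia.
Qed.

(** Vertex 1 is excluded because y_0 and y_1 both leave it. *)
Lemma edge_src_inj e f : esrc e = esrc f -> 1 < esrc e -> slack e = slack f -> e = f.
Proof.
case: e f => [a|a] [b|b] //=.
  by move=> [] ab _ _; congr inl; apply: val_inj.
move=> ab lt1 _; congr inr; apply: val_inj; move: ab lt1.
by case: eqP => /=; case: eqP => /=; lia.
Qed.

(** Vertex [n] is excluded because y_(n-2) and y_(n-1) both enter it. *)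
Lemma edge_tgt_inj e f : etgt e = etgt f -> etgt e < n -> slack e = slack f -> e = f.
Proof.
case: e f => [a|a] [b|b] //=.
  by move=> [] ab _ _; congr inl; apply: val_inj.
move=> ab lt1 _; congr inr; apply: val_inj; move: ab lt1.
by case: eqP => /=; case: eqP => /=; lia.
Qed.

Lemma walk_catE u p w q v : walk u p w -> walk u (p ++ q) v = walk w q v.
Proof. by elim: p u => [|e p IH] u /=; [move/eqP->|case/andP=> /eqP->; rewrite eqxx; apply: IH]. Qed.

Lemma walk_split u p q v : walk u (p ++ q) v -> exists2 w, walk u p w & walk w q v.
Proof.
elim: p u => [|e p IH] u /=; first by exists u.
by case/andP=> -> /IH [w]; exists w.
Qed.

Lemma walk_size u p v : walk u p v -> u + size p <= v.
Proof.
elim: p u => [|e p IH] u /=; first by move/eqP->; rewrite addn0.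
by case/andP=> /eqP<- /IH; have := esrc_lt_etgt e; lia.
Qed.

Lemma walk_le u p v : walk u p v -> u <= v.
Proof. by move/walk_size; lia. Qed.

Lemma walk_nil u p : walk u p u -> p = [::].
Proof. by move/walk_size => H; apply: size0nil; lia. Qed.

Lemma walk_rcons u p e v : walk u (rcons p e) v = walk u p (esrc e) && (etgt e == v).
Proof.
elim: p u => [|f p IH] u /=; first by rewrite eq_sym.
by rewrite IH andbA.
Qed.

Lemma walk_unsplit u p q v w : walk u (p ++ q) v -> walk w q v -> walk u p w.
Proof.
case/walk_split=> w' up w'q; case: q w'q => [|e q] /=.
  by move/eqP=> w'v /eqP wv; rewrite wv -w'v.
by case/andP=> /eqP ew' _ /andP[/eqP ew _]; rewrite -ew ew'.
Qed.

(** Vertices increase along a path, so of two cuts of one path the one at the smaller vertex comes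
    first. *)
Lemma cat_walk_le u P Q A B i j : P ++ Q = A ++ B -> walk u P i -> walk u A j ->
  j <= i -> exists E, [/\ P = A ++ E, walk j E i & B = E ++ Q].
Proof.
elim: A P u => [|a A IH] P u /=; first by move=> <- ? /eqP<- _; exists P.
case: P => [|p P] /=.
  move=> _ /eqP<- /andP[/eqP<- /walk_le] + ji.
  by have := esrc_lt_etgt a; lia.
case=> <- PQ /andP[_ Pi] /andP[_ Aj] ji.
by have [E [-> ? ->]] := IH _ _ PQ Pi Aj ji; exists E.
Qed.

Lemma cat_walk_eq u P Q A B i : P ++ Q = A ++ B -> walk u P i -> walk u A i ->
  P = A /\ Q = B.
Proof.
move=> eq Pi Ai; have [E [-> /walk_nil-> ->]] := cat_walk_le eq Pi Ai (leqnn i).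
by rewrite cats0.
Qed.

Lemma suffix_irr Q : suffix_lt Q Q = false. Proof. exact: first_diff_irr. Qed.
Lemma prefix_irr P : prefix_lt P P = false. Proof. exact: first_diff_irr. Qed.

Lemma suffix_trans : transitive (@suffix_lt n).
Proof.
apply: first_diff_trans; first by move=> e; rewrite /out_lt; case: slack; rewrite ?andbF.
by move=> f e g /and3P[_ _ nf] /and3P[_ sf _]; rewrite sf in nf.
Qed.

Lemma prefix_trans : transitive (@prefix_lt n).
Proof.
have tr : transitive (first_diff_lt (@in_lt n)).
  apply: first_diff_trans; first by move=> e; rewrite /in_lt; case: slack; rewrite ?andbF.
  by move=> f e g /and3P[_ _ nf] /and3P[_ sf _]; rewrite nf in sf.
by move=> q p r; apply: tr.
Qed.

Lemma suffix_cat z Q Q' : suffix_lt (z ++ Q) (z ++ Q') = suffix_lt Q Q'.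
Proof. exact: first_diff_cat. Qed.

Lemma prefix_cat z P P' : prefix_lt (P ++ z) (P' ++ z) = prefix_lt P P'.
Proof. by rewrite /prefix_lt !rev_cat; exact: first_diff_cat. Qed.

Lemma suffix_cons e Q f Q' :
  suffix_lt (e :: Q) (f :: Q') = if e == f then suffix_lt Q Q' else out_lt e f.
Proof. by []. Qed.

Lemma prefix_rcons P e P' f :
  prefix_lt (rcons P e) (rcons P' f) = if e == f then prefix_lt P P' else in_lt e f.
Proof. by rewrite /prefix_lt !rev_rcons. Qed.

Lemma suffix_slack e f Q Q' : esrc e = esrc f -> slack e -> ~~ slack f ->
  suffix_lt (e :: Q) (f :: Q').
Proof.
move=> ef se nsf; rewrite suffix_cons /out_lt ef eqxx se nsf.
by case: eqP => // eqef; rewrite -eqef se in nsf.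
Qed.

Lemma prefix_slack e f P P' : etgt e = etgt f -> ~~ slack e -> slack f ->
  prefix_lt (rcons P e) (rcons P' f).
Proof.
move=> ef nse sf; rewrite prefix_rcons /in_lt ef eqxx sf nse.
by case: eqP => // eqef; rewrite eqef sf in nse.
Qed.

Lemma suffix_total u v Q Q' : 1 < u -> walk u Q v -> walk u Q' v -> Q <> Q' ->
  suffix_lt Q Q' || suffix_lt Q' Q.
Proof.
elim: Q u Q' => [|e Q IH] u [|f Q'] u1 //.
- by move=> /eqP uv; rewrite uv => /walk_nil.
- by move=> + /eqP uv; rewrite uv => /walk_nil.
case/andP=> /eqP eu Qv /andP[/eqP fu Q'v] neq.
rewrite !suffix_cons; have [ef|nef] := eqVneq e f.
  apply: IH (etgt e) _ _ Qv _ _; last by move=> QQ; apply: neq; rewrite ef QQ.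
    by have := esrc_lt_etgt e; lia.
  by rewrite ef.
rewrite /out_lt eu fu eqxx /=; move/eqP: nef => nef.
have : slack e <> slack f by move=> sl; apply: nef; apply: edge_src_inj => //; lia.
by case: slack; case: slack.
Qed.

Lemma prefix_total u v P P' : v < n -> walk u P v -> walk u P' v -> P <> P' ->
  prefix_lt P P' || prefix_lt P' P.
Proof.
elim/last_ind: P v P' => [|P e IH] v P' vn.
  by move=> /eqP <- /walk_nil ->.
case/lastP: P' => [|P' f]; first by move=> + /eqP uv; rewrite uv => /walk_nil ->.
rewrite !walk_rcons => /andP[Pe /eqP ev] /andP[P'f /eqP fv] neq.
rewrite !prefix_rcons; have [ef|nef] := eqVneq e f.
  apply: IH (esrc e) _ _ Pe _ _; last by move=> QQ; apply: neq; rewrite ef QQ.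
    by have := esrc_lt_etgt e; lia.
  by rewrite ef.
rewrite /in_lt ev fv eqxx /=; move/eqP: nef => nef.
have : slack e <> slack f by move=> sl; apply: nef; apply: edge_tgt_inj => //; lia.
by case: slack; case: slack.
Qed.

(** * Conflicts *)

Definition crossing P Q P' Q' :=
  (prefix_lt P P' && suffix_lt Q' Q) || (prefix_lt P' P && suffix_lt Q Q').

Definition compatible (r r' : seq (edge n)) := forall i, ~ @conflict_at n i r r'.

Lemma crossing_sym P Q P' Q' : crossing P Q P' Q' = crossing P' Q' P Q.
Proof. by rewrite /crossing orbC. Qed.

Lemma conflict_sym i r r' : @conflict_at n i r r' -> conflict_at i r' r.
Proof.
move=> [inn [P [Q [P' [Q' [-> -> w w' x]]]]]]; split=> //.
by exists P', Q', P, Q; split=> //; rewrite orbC.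
Qed.

Lemma compatible_sym r r' : compatible r r' -> compatible r' r.
Proof. by move=> c i /conflict_sym; apply: c. Qed.

Lemma compatible_refl r : compatible r r.
Proof.
move=> i [_ [P [Q [P' [Q' [-> eq /andP[Pi _] /andP[P'i _]]]]]]].
by have [-> ->] := cat_walk_eq eq Pi P'i; rewrite prefix_irr suffix_irr.
Qed.

Lemma crossing_conflict i P Q P' Q' : inner n i -> walk 1 P i -> walk i Q n ->
  walk 1 P' i -> walk i Q' n -> crossing P Q P' Q' -> conflict_at i (P ++ Q) (P' ++ Q').
Proof.
move=> inn Pi Qi P'i Q'i x; split=> //; exists P, Q, P', Q'.
by split=> //; apply/andP.
Qed.

(** A conflict settled on the stretch from [j] to [i] would already be one of [P ++ Q] with [t].
    Hence [t] follows that stretch, and the crossing persists at [i]. *)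
Lemma glue_left i j P Q Q' t : walk 1 P i -> walk i Q n -> walk i Q' n ->
  compatible (P ++ Q) t -> conflict_at j (P ++ Q') t -> j <= i ->
  exists A B, [/\ t = A ++ B, walk 1 A i, walk i B n & crossing P Q' A B].
Proof.
move=> Pi Qi Q'i cmp [jn [A' [B' [A [B [PQ' tE /andP[A'j B'j] /andP[Aj Bj] x]]]]]] ji.
have [E [PE Ei B'E]] := cat_walk_le PQ' Pi A'j ji.
have [[B2 BE]|H] := first_diff_stable (@out_lt n) E B.
  exists (A ++ E), B2; split.
  - by rewrite tE BE catA.
  - by rewrite (walk_catE _ _ Aj).
  - by move: Bj; rewrite /suffix_at BE (walk_catE _ _ Ei).
  - by move: x; rewrite B'E BE PE /crossing !prefix_cat !suffix_cat.
case: (cmp j); rewrite PE -catA tE; apply: crossing_conflict => //.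
  by rewrite (walk_catE _ _ Ei).
move: x; rewrite /crossing B'E /suffix_lt; have [-> ->] := H Q' Q.
by [].
Qed.

Lemma glue_right i j P P' Q t : walk 1 P i -> walk 1 P' i -> walk i Q n ->
  compatible (P' ++ Q) t -> conflict_at j (P ++ Q) t -> i <= j ->
  exists A B, [/\ t = A ++ B, walk 1 A i, walk i B n & crossing P Q A B].
Proof.
move=> Pi P'i Qi cmp [jn [A' [B' [A [B [PQ tE /andP[A'j B'j] /andP[Aj Bj] x]]]]]] ij.
have [E [A'E Ej QE]] := cat_walk_le (esym PQ) A'j Pi ij.
have [[A2 rA]|H] := first_diff_stable (@in_lt n) (rev E) (rev A).
  have AE : A = rev A2 ++ E by rewrite -[A]revK rA rev_cat revK.
  exists (rev A2), (E ++ B); split.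
  - by rewrite tE AE catA.
  - by apply: walk_unsplit Ej; rewrite -AE.
  - by rewrite (walk_catE _ _ Ej).
  - by move: x; rewrite A'E AE QE /crossing !prefix_cat !suffix_cat.
case: (cmp j); rewrite QE catA tE; apply: crossing_conflict => //.
  by rewrite (walk_catE _ _ P'i).
move: x; rewrite /crossing A'E /prefix_lt !rev_cat; have [-> ->] := H (rev P) (rev P').
by [].
Qed.

(** Left of [i] the splice is controlled by [P ++ Q], right of it by [P' ++ Q'], so a new conflict
    must be visible at [i]. *)
Lemma glue i P P' Q Q' t : walk 1 P i -> walk i Q n -> walk 1 P' i -> walk i Q' n ->
  compatible (P ++ Q) t -> compatible (P' ++ Q') t ->
  (forall A B, t = A ++ B -> walk 1 A i -> walk i B n -> ~~ crossing P Q' A B) ->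
  compatible (P ++ Q') t.
Proof.
move=> Pi Qi P'i Q'i c c' nx j cf.
have [A [B [tE Ai Bi]]] : exists A B,
    [/\ t = A ++ B, walk 1 A i, walk i B n & crossing P Q' A B].
  have [ji|ij] := leqP j i; first exact: glue_left c cf ji.
  exact: glue_right c' cf (ltnW ij).
by apply/negP/nx.
Qed.

(** * Routes of a maximal clique *)

Lemma exists_slack i : 0 < i < n -> exists2 e : edge n, slack e & esrc e = i.
Proof.
case/andP=> i0 ltin; have lti : i.-1 < n.-1 by lia.
by exists (inl (Ordinal lti)) => //=; lia.
Qed.

Lemma exists_nslack i : 0 < i < n -> exists2 e : edge n, ~~ slack e & esrc e = i.
Proof.
by case/andP=> i0 ltin; exists (inr (Ordinal ltin)) => //=; case: eqP; lia.
Qed.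

Lemma exists_walk u : 0 < u <= n -> exists p : seq (edge n), walk u p n.
Proof.
move: {2}(n - u) (erefl (n - u)) => d; elim: d u => [|d IH] u ed ub.
  by exists [::] => /=; apply/eqP; lia.
have [|e se ue] := @exists_slack u; first lia.
have te := etgt_slack se.
have [||p pn] := IH (etgt e); try (rewrite te; lia).
by exists (e :: p); rewrite /= ue eqxx.
Qed.

(** Raw sequences can be cut and concatenated without tracking length bounds. *)
Definition routes (C : {set edge_seq n}) : seq (seq (edge n)) := [seq val r | r <- enum C].

Definition through C v P Q := [&& P ++ Q \in routes C, walk 1 P v & walk v Q n].

Lemma mem_routes (C : {set edge_seq n}) (r : edge_seq n) : (val r \in routes C) = (r \in C).
Proof. by rewrite (mem_map val_inj) mem_enum. Qed.

Lemma routesP (C : {set edge_seq n}) s : s \in routes C -> exists2 r, r \in C & s = val r.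
Proof. by case/mapP=> r; rewrite mem_enum => rC ->; exists r. Qed.

Lemma through_extremal C v (lt : rel (seq (edge n) * seq (edge n)))
    (p : pred (seq (edge n) * seq (edge n))) P0 Q0 :
  irreflexive lt -> transitive lt -> through C v P0 Q0 -> p (P0, Q0) ->
  exists P Q, [/\ through C v P Q, p (P, Q) &
    forall A B, through C v A B -> p (A, B) -> ~~ lt (P, Q) (A, B)].
Proof.
move=> irr tr th0 p0.
(* All cuts of all routes of [C], a finite list in which an extremal element exists. *)
pose L := [seq a <- [seq (take k r, drop k r) | r <- routes C, k <- iota 0 n.+1] |
            p a && through C v a.1 a.2].
have inL A B : (A, B) \in L = p (A, B) && through C v A B.
  rewrite mem_filter; apply: andb_idr => /andP[_ th].
  have {th}/and3P[AB Av Bn] : through C v A B := th.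
  apply/allpairsPdep; exists (A ++ B), (size A); split; [exact: AB| |].
    by rewrite mem_iota; have := walk_size Av; have := walk_le Bn; lia.
  by rewrite take_size_cat // drop_size_cat.
have /(exists_extremal irr tr) [[P Q]] : (P0, Q0) \in L by rewrite inL p0.
rewrite inL => /andP[pPQ thPQ] ext; exists P, Q; split=> // A B thAB pAB.
by apply: ext; rewrite inL pAB.
Qed.

Section MaximalClique.
Context (C : {set edge_seq n}) (maxC : maximal_clique C).

Lemma routes_walk s : s \in routes C -> walk 1 s n.
Proof. by case: maxC => -[rC _] _ /routesP[r /rC ? ->]. Qed.

Lemma routes_compatible s t : s \in routes C -> t \in routes C -> compatible s t.
Proof.
case: maxC => -[_ cC] _ /routesP[r rC ->] /routesP[r' r'C ->] i.
exact: cC.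
Qed.

Lemma routes_maximal t : walk 1 t n -> (forall s, s \in routes C -> compatible s t) ->
  t \in routes C.
Proof.
move=> tn ct; have szt : size t <= n by have := walk_size tn; lia.
pose T := Bseq szt : edge_seq n; rewrite -[t]/(val T) mem_routes.
case: maxC => -[rC cC] /(_ (T |: C)) <-; rewrite ?finset.setU11 ?finset.subsetUr //; split.
  by move=> r /finset.setU1P[->|/rC].
move=> r r' i /finset.setU1P[->|rr] /finset.setU1P[->|rr'].
- exact: compatible_refl.
- by apply: compatible_sym; apply: ct; rewrite mem_routes.
- by apply: ct; rewrite mem_routes.
- exact: cC.
Qed.

Lemma through_not_crossing i P Q A B : inner n i -> through C i P Q -> through C i A B ->
  ~~ crossing P Q A B.
Proof.
move=> inn /and3P[PQ Pi Qi] /and3P[AB Ai Bi]; apply/negP=> x.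
exact: (routes_compatible PQ AB) (crossing_conflict inn Pi Qi Ai Bi x).
Qed.

Lemma through_glue i P P' Q Q' : through C i P Q -> through C i P' Q' ->
  (forall A B, through C i A B -> ~~ crossing P Q' A B) -> through C i P Q'.
Proof.
move=> /and3P[PQ Pi Qi] /and3P[PQ' P'i Q'i] nx; rewrite /through Pi Q'i !andbT.
apply: routes_maximal => [|s sC]; first by rewrite (walk_catE _ _ Pi).
apply: compatible_sym; apply: (glue Pi Qi P'i Q'i); try exact: routes_compatible.
by move=> A B sE Ai Bi; apply: nx; rewrite /through -sE sC Ai.
Qed.

Lemma insert_left v e P0 Q0 : inner n v -> through C v P0 Q0 -> esrc e = v ->
  (forall A B, A ++ e :: B \notin routes C) ->
  exists P Q, through C v P Q /\
    forall A B Z, through C v A B -> ~~ crossing P (e :: Z) A B.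
Proof.
move=> inn th0 ev unused.
have tail A B : through C v A B -> exists2 f, e != f & exists B', B = f :: B'.
  move=> /and3P[AB Av]; case: B AB => [|f B] AB /=.
    by move/eqP=> vn; move: inn; rewrite vn /inner ltnn andbF.
  move=> _; exists f; last by exists B.
  by apply: contraTneq AB => <-.
have [se|nse] := boolP (slack e).
- have [||P [Q [thPQ _ ext]]] := @through_extremal C v (fun a b => prefix_lt b.1 a.1) predT _ _ _ _ th0 isT.
    by move=> a; rewrite /= prefix_irr.
    by move=> b a c ab bc; apply: prefix_trans bc ab.
  exists P, Q; split=> // A B Z thAB; have [f /negPf nef [B' ->]] := tail _ _ thAB.
  rewrite /crossing !suffix_cons [f == e]eq_sym nef /out_lt se /= !andbF /=.
  by rewrite (negPf (ext _ _ thAB isT)).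
- have [||P [Q [thPQ _ ext]]] := @through_extremal C v (fun a b => prefix_lt a.1 b.1) predT _ _ _ _ th0 isT.
    by move=> a; rewrite /= prefix_irr.
    by move=> b a c; apply: prefix_trans.
  exists P, Q; split=> // A B Z thAB; have [f /negPf nef [B' ->]] := tail _ _ thAB.
  rewrite /crossing !suffix_cons [f == e]eq_sym nef /out_lt (negPf nse) /= !andbF orbF.
  by rewrite (negPf (ext _ _ thAB isT)).
Qed.

(** Incoming edges are framed the other way round, so a slack [e] calls for the last suffix and a
    nonslack one for the first. *)
Lemma insert_right v e P0 Q0 : inner n v -> through C v P0 Q0 -> etgt e = v ->
  (forall A B, A ++ e :: B \notin routes C) ->
  exists P Q, through C v P Q /\
    forall A B Z, through C v A B -> ~~ crossing (rcons Z e) Q A B.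
Proof.
move=> inn th0 ev unused.
have tail A B : through C v A B -> exists2 f, e != f & exists A', A = rcons A' f.
  move=> /and3P[AB + Bv]; case/lastP: A AB => [|A f] AB.
    by move/eqP=> vn; move: inn; rewrite -vn /inner ltnn.
  move=> _; exists f; last by exists A.
  by apply: contraTneq AB => <-; rewrite cat_rcons.
have [se|nse] := boolP (slack e).
- have [||P [Q [thPQ _ ext]]] := @through_extremal C v (fun a b => suffix_lt a.2 b.2) predT _ _ _ _ th0 isT.
    by move=> a; rewrite /= suffix_irr.
    by move=> b a c; apply: suffix_trans.
  exists P, Q; split=> // A B Z thAB; have [f /negPf nef [A' AE]] := tail _ _ thAB.
  rewrite /crossing AE !prefix_rcons [f == e]eq_sym nef /in_lt se /= !andbF /=.
  by rewrite (negPf (ext _ _ thAB isT)) andbF.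
- have [||P [Q [thPQ _ ext]]] := @through_extremal C v (fun a b => suffix_lt b.2 a.2) predT _ _ _ _ th0 isT.
    by move=> a; rewrite /= suffix_irr.
    by move=> b a c ab bc; apply: suffix_trans bc ab.
  exists P, Q; split=> // A B Z thAB; have [f /negPf nef [A' AE]] := tail _ _ thAB.
  rewrite /crossing AE !prefix_rcons [f == e]eq_sym nef /in_lt (negPf nse) /= !andbF orbF.
  by rewrite (negPf (ext _ _ thAB isT)) andbF.
Qed.

(* A path unused by [C] could be completed to a route compatible with [C], by an
   extremal prefix at its start and an extremal suffix at its end. *)
Lemma no_unused_path v w e f (u u1 u2 : seq (edge n)) :
  0 < v -> w <= n -> walk v u w -> u = e :: u1 -> u = rcons u2 f ->
  (forall A B, A ++ e :: B \notin routes C) ->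
  (forall A B, A ++ f :: B \notin routes C) ->
  (forall j p q A B, u = p ++ q -> walk v p j -> v < j < w -> ~~ through C j A B) ->
  (inner n v -> exists P Q, through C v P Q) ->
  (inner n w -> exists P Q, through C w P Q) -> False.
Proof.
move=> v0 wn uw ue uf une unf mid thv thw.
have ev : esrc e = v by move: uw; rewrite ue /= => /andP[/eqP].
have fw : etgt f = w by move: uw; rewrite uf walk_rcons => /andP[_ /eqP].
have vw : v < w.
  by have := walk_le uw; rewrite leq_eqVlt => /predU1P[vw|//]; move: uw; rewrite vw => /walk_nil; rewrite ue.
have [P [Pv nxP]] : exists P, walk 1 P v /\ (inner n v -> exists2 Q, through C v P Q &
    forall A B Z, through C v A B -> ~~ crossing P (e :: Z) A B).
  have [inn|ninn] := boolP (inner n v).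
    have [P0 [Q0 th0]] := thv inn.
    have [P [Q [th nx]]] := insert_left inn th0 ev une.
    by exists P; split; [case/and3P: th | move=> _; exists Q].
  by exists [::]; split=> //=; move: ninn; rewrite /inner; apply: contraNT => ?; lia.
have [Q [Qw nxQ]] : exists Q, walk w Q n /\ (inner n w -> exists2 P, through C w P Q &
    forall A B Z, through C w A B -> ~~ crossing (rcons Z f) Q A B).
  have [inn|ninn] := boolP (inner n w).
    have [P0 [Q0 th0]] := thw inn.
    have [P' [Q [th nx]]] := insert_right inn th0 fw unf.
    by exists Q; split; [case/and3P: th | move=> _; exists P'].
  by exists [::]; split=> //=; move: ninn; rewrite /inner; apply: contraNT => ?; lia.
have uQn : walk v (u ++ Q) n by rewrite (walk_catE _ _ uw).
have Puw : walk 1 (P ++ u) w by rewrite (walk_catE _ _ Pv).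
case/negP: (une P (u1 ++ Q)); rewrite -cat_cons -ue.
apply: routes_maximal => [|t tC]; first by rewrite (walk_catE _ _ Pv).
apply: compatible_sym => j cf; have [jn [A' [B' [A [B [TE tE /andP[A'j B'j] /andP[Aj Bj] x]]]]]] := cf.
(* Conflicts up to [v] are pushed to [v] and those from [w] on to [w], where the extremal choices
   exclude them; in between no route of [C] passes. *)
have [jv|vj] := leqP j v.
  have inn : inner n v.
    by rewrite /inner (leq_trans _ jv) ?(leq_trans vw) //; case/andP: jn.
  have [Q0 th0 nx] := nxP inn; have /and3P[PQ0 _ Q0n] := th0.
  have [A0 [B0 [tE' A0v B0n]]] := glue_left Pv Q0n uQn (routes_compatible PQ0 tC) cf jv.
  by apply/negP; rewrite ue; apply: nx; rewrite /through -tE' tC A0v.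
have [wj|jw] := leqP w j.
  have inn : inner n w.
    by rewrite /inner (leq_ltn_trans v0 vw) (leq_ltn_trans wj) //; case/andP: jn.
  have [P0 th0 nx] := nxQ inn; have /and3P[PQ0 P0n _] := th0.
  move: cf; rewrite catA => cf.
  have [A0 [B0 [tE' A0v B0n]]] := glue_right Puw P0n Qw (routes_compatible PQ0 tC) cf wj.
  by apply/negP; rewrite uf -rcons_cat; apply: nx; rewrite /through -tE' tC A0v.
have [E [A'E Ej uQE]] := cat_walk_le (esym TE) A'j Pv (ltnW vj).
have [F [uE _ _]] := cat_walk_le uQE uw Ej (ltnW jw).
have vjw : v < j < w by rewrite vj.
case/negP: (mid j E F A B uE Ej vjw).
by rewrite /through -tE; apply/and3P.
Qed.

Lemma walk_visits u r v i : walk u r v -> u < i < v ->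
  (exists P Q, [/\ r = P ++ Q, walk u P i & walk i Q v]) \/
  (exists P e Q, [/\ r = P ++ e :: Q, walk u P (esrc e), walk (etgt e) Q v & esrc e < i < etgt e]).
Proof.
elim: r u => [|e r IH] u /=; first by move/eqP->; lia.
case/andP=> /eqP eu rv uiv; have [ie|ei|ei] := ltngtP i (etgt e).
- by right; exists [::], e, r; rewrite /= eu eqxx ie; split=> //; lia.
- have [|[P [Q [rE Pi Qv]]]|[P [f [Q [rE Pi Qv lt]]]]] := IH _ rv; first lia.
    by left; exists (e :: P), Q; rewrite /= eu eqxx rE.
  by right; exists (e :: P), f, Q; rewrite /= eu eqxx rE.
- by left; exists [:: e], r; rewrite /= eu eqxx ei eqxx.
Qed.

(* If [i] is unvisited, all routes jump over it from [i.-1] to [i.+1], and the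
   path [x_(i-1), x_i] is unused. *)
Lemma inner_visited i : inner n i -> exists P Q, through C i P Q.
Proof.
move=> inn; have [i1 ltin] := andP inn.
case: (boolp.pselect (exists P Q, through C i P Q)) => // nth.
have nthr P Q : ~~ through C i P Q by apply/negP=> th; apply: nth; exists P, Q.
have [|e se ev] := @exists_slack i.-1; first lia.
have [|f sf fv] := @exists_slack i; first lia.
have te := etgt_slack se; have tf := etgt_slack sf.
have ei : etgt e = i by lia.
have [s sC] : exists s, s \in routes C.
  have [|p pn] := @exists_walk 1; first lia.
  case: (boolp.pselect (exists s, s \in routes C)) => // nr; exists p.
  by apply: routes_maximal => // s sC; case: nr; exists s.
have [P [g [Q [sE Pg Qg g1 g2]]]] : exists P g Q, [/\ s = P ++ g :: Q, walk 1 P (esrc g),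
    walk (etgt g) Q n, esrc g = i.-1 & etgt g = i.+1].
  have [[P [Q [sE Pi Qi]]]|[P [g [Q [sE Pi Qi lt]]]]] := walk_visits (routes_walk sC) inn.
    by case/negP: (nthr P Q); rewrite /through -sE sC Pi.
  by exists P, g, Q; split=> //; have := etgt_le2 g; lia.
apply: (False_ind _ (@no_unused_path i.-1 i.+1 e f [:: e; f] [:: f] [:: e] _ _ _ erefl erefl _ _ _ _ _)) => //=.
- lia.
- by rewrite ev ei fv tf fv !eqxx.
- move=> A B; apply/negP=> AB; have := routes_walk AB; rewrite -cat_rcons => /walk_split[w Aw Bw].
  move: (Aw); rewrite walk_rcons ei => /andP[_ /eqP iw].
  by case/negP: (nthr (rcons A e) B); rewrite /through cat_rcons AB iw Aw.
- move=> A B; apply/negP=> AB; have := routes_walk AB => /walk_split[w Aw Bw].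
  move: (Bw); rewrite /= fv => /andP[/eqP iw _].
  by case/negP: (nthr A (f :: B)); rewrite /through AB iw Aw.
- by move=> j p q A B _ _ lt; have -> : j = i by lia.
- move=> _; exists P, (g :: Q); rewrite /through -sE sC -g1 Pg.
  by rewrite -/(walk _ (g :: Q) n) /= eqxx Qg.
- move=> _; exists (rcons P g), Q; rewrite /through cat_rcons -sE sC -g2 walk_rcons Pg Qg.
  by rewrite eqxx.
Qed.

Lemma edge_used e : exists A B, through C (esrc e) A (e :: B).
Proof.
case: (boolp.pselect (exists A B, A ++ e :: B \in routes C)) => [[A [B AB]]|nu].
  exists A, B; rewrite /through AB; have [w Aw] := walk_split (routes_walk AB).
  by rewrite /= => /andP[/eqP we ->]; rewrite we Aw eqxx.
have un A B : A ++ e :: B \notin routes C.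
  by apply/negP=> AB; apply: nu; exists A, B.
case: (@no_unused_path (esrc e) (etgt e) e e [:: e] [::] [::]) => //.
- exact: esrc_gt0.
- exact: etgt_le.
- by rewrite /= !eqxx.
- move=> j [|a [|b p]] q A B //=; first by move=> _ /eqP->; rewrite ltnn.
  by case=> -> _; rewrite eqxx /= => /eqP->; rewrite ltnn andbF.
- exact: inner_visited.
- exact: inner_visited.
Qed.

(** The last prefix extended by [e] is glued to the suffix of the first route continuing with [f];
    no crossing arises, so maximality puts the result in [C]. *)
Lemma common_prefix i e f : inner n i -> esrc e = i -> slack e -> esrc f = i -> ~~ slack f ->
  exists P B B', through C i P (e :: B) /\ through C i P (f :: B').
Proof.
move=> inn ei se fi nsf; have nef : e <> f by move=> ef; rewrite -ef se in nsf.
have [Ae [Be]] := edge_used e; rewrite ei => the.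
have [Af [Bf]] := edge_used f; rewrite fi => thf.
have starts (B : seq (edge n)) A : through C i A B -> ohead B = Some e \/ ohead B = Some f.
  case: B => [|g B] /and3P[_ _].
    by move/eqP=> iN; move: inn; rewrite iN /inner ltnn andbF.
  case/andP=> /eqP gi _; have [sg|nsg] := boolP (slack g); [left|right]; congr Some.
    by apply: edge_src_inj; rewrite ?gi ?ei ?sg ?se //; case/andP: inn.
  by apply: edge_src_inj; rewrite ?gi ?fi ?(negPf nsg) ?(negPf nsf) //; case/andP: inn.
have [||P [Q [thP hP ext]]] := @through_extremal C i (fun a b => prefix_lt a.1 b.1)
    (fun a => ohead a.2 == Some e) _ _ _ _ the (eqxx _).
  by move=> a; rewrite /= prefix_irr.
  by move=> b a c; apply: prefix_trans.
(* Reversed lexicographic order: the extremal pair is the first one, with suffixes breaking ties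
   between equal prefixes. *)
pose lt (b a : seq (edge n) * seq (edge n)) :=
  prefix_lt a.1 b.1 || (a.1 == b.1) && suffix_lt a.2 b.2.
have [||P' [Q' [thP' hP' ext']]] := @through_extremal C i lt
    (fun a => ohead a.2 == Some f) _ _ _ _ thf (eqxx _).
  by move=> a; rewrite /lt prefix_irr suffix_irr andbF.
  move=> b a c /orP[ba|/andP[/eqP ba sba]] /orP[cb|/andP[/eqP cb scb]]; rewrite /lt.
  - by rewrite (prefix_trans cb ba).
  - by rewrite cb ba.
  - by rewrite -ba cb.
  - by rewrite cb ba eqxx (suffix_trans scb sba) orbT.
exists P; case: Q hP thP ext => [|e' Q] //= /eqP[->] thP ext.
case: Q' hP' thP' ext' => [|f' Q'] //= /eqP[->] thP' ext'.
exists Q, Q'; split=> //; apply: (through_glue thP thP') => A B thAB.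
apply/negP; rewrite /crossing => /orP[/andP[PA BQ']|/andP[AP Q'B]].
- case: (starts _ _ thAB) => hB.
    by move: (ext _ _ thAB); rewrite hB eqxx PA => /(_ isT).
  have [AP'|nAP'] := eqVneq A P'.
    by move: (ext' _ _ thAB); rewrite hB eqxx /lt /= AP' eqxx BQ' orbT => /(_ isT).
  have lti : i < n by case/andP: inn.
  have /and3P[_ Ai _] := thAB; have /and3P[_ P'i _] := thP'.
  have /orP[AP'|P'A] := prefix_total lti Ai P'i (elimN eqP nAP').
    by move: (ext' _ _ thAB); rewrite hB eqxx /lt /= AP' => /(_ isT).
  by have := through_not_crossing inn thP' thAB; rewrite /crossing P'A BQ'.
(* A suffix after [f :: Q'] starts with [f], hence also comes after [e :: Q]; with [A] before [P]
   this is a crossing inside [C]. *)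
- case: (starts _ _ thAB); case: B thAB Q'B => // g B thAB + [geq]; rewrite geq suffix_cons.
    rewrite /out_lt (negPf nsf) !andbF; case: eqP => // fe; case: nef; exact/esym.
  rewrite eqxx => Q'B; rewrite geq in thAB.
  have := through_not_crossing inn thP thAB.
  by rewrite /crossing AP (@suffix_slack e f) ?orbT ?ei ?fi.
Qed.

(** Of two such prefixes, the earlier one followed by [f] and the later one followed by [e] would
    cross. *)
Lemma common_prefix_unique i e f P P' B B' A A' : inner n i ->
  esrc e = i -> slack e -> esrc f = i -> ~~ slack f ->
  through C i P (e :: B) -> through C i P (f :: B') ->
  through C i P' (e :: A) -> through C i P' (f :: A') -> P = P'.
Proof.
move=> inn ei se fi nsf.
have lt Z Z' : suffix_lt (e :: Z) (f :: Z') by apply: suffix_slack; rewrite ?ei ?fi.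
move=> PB PB' PA PA'; have [//|neq] := eqVneq P P'.
have lti : i < n by case/andP: inn.
have /and3P[_ Pi _] := PB; have /and3P[_ P'i _] := PA.
have /orP[PP'|PP'] := prefix_total lti Pi P'i (elimN eqP neq).
  by have := through_not_crossing inn PB' PA; rewrite /crossing PP' lt.
by have := through_not_crossing inn PB PA'; rewrite /crossing PP' lt orbT.
Qed.

End MaximalClique.

Lemma through_rcons C v A e Z :
  through C v (rcons A e) Z = (etgt e == v) && through C (esrc e) A (e :: Z).
Proof.
rewrite /through cat_rcons walk_rcons /= eqxx /=; have [->|] := eqVneq (etgt e) v.
  by rewrite andbT.
by rewrite !(andbF, andFb).
Qed.

Lemma walk_mem_src u p v e : walk u p v -> e \in p -> u <= esrc e.
Proof.
elim: p u => //= f p IH u /andP[/eqP fu pv]; rewrite inE => /predU1P[->|ep]; first by rewrite fu.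
by have := IH _ pv ep; have := esrc_lt_etgt f; lia.
Qed.

(** * Exchanging a route *)

(** By transitivity, a route crossing the splice at [i] crosses [P ++ Q] or [P' ++ Q']. Only
    [P ++ Q] itself needs separate care, since it does conflict with [P' ++ Q']: it shares [P] with
    the splice, and a conflict beyond [i] would be a later one of the two original routes. *)
Lemma resolvent C i P Q P' Q' : maximal_clique C -> inner n i ->
  through C i P Q -> walk 1 P' i -> walk i Q' n -> crossing P Q P' Q' ->
  (forall t, t \in routes C -> t <> P ++ Q -> compatible (P' ++ Q') t) ->
  (forall j, i < j -> ~ conflict_at j (P ++ Q) (P' ++ Q')) ->
  through C i P Q'.
Proof.
move=> maxC inn th P'i Q'i x cmp last; have /and3P[PQ Pi Qi] := th.
rewrite /through Pi Q'i !andbT.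
apply: (routes_maximal maxC) => [|s sC]; first by rewrite (walk_catE _ _ Pi).
apply: compatible_sym; have [->|/eqP nes] := eqVneq s (P ++ Q).
  move=> j [jn [A' [B' [A [B [TE rE /andP[A'j B'j] /andP[Aj Bj]]]]]]].
  rewrite -/(crossing _ _ _ _) => cr.
  have [ji|ij] := leqP j i.
    have [E [PE _ _]] := cat_walk_le TE Pi A'j ji.
    have [F [PF _ _]] := cat_walk_le rE Pi Aj ji.
    rewrite PE in PF; have [AA _] := cat_walk_eq PF A'j Aj.
    by move: cr; rewrite /crossing AA prefix_irr.
  have [E [A'E Ej Q'E]] := cat_walk_le (esym TE) A'j Pi (ltnW ij).
  have [F [AF Fj QF]] := cat_walk_le (esym rE) Aj Pi (ltnW ij).
  (* Unless the two prefixes at [j] coincide, their comparison is settled after [i], so [P] may be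
     replaced by [P']. *)
  have [[q' rq]|H] := first_diff_stable (@in_lt n) (rev E) (rev A).
    have AE : A = rev q' ++ E by rewrite -[A]revK rq rev_cat revK.
    have q'i : walk 1 (rev q') i by apply: walk_unsplit Ej; rewrite -AE.
    have [PE EF] := cat_walk_eq (etrans (esym AF) AE) Pi q'i.
    by move: cr; rewrite /crossing A'E AF EF prefix_irr.
  apply: (last j ij); rewrite QF Q'E !catA -AF; apply: crossing_conflict => //.
    by rewrite (walk_catE _ _ P'i).
  rewrite crossing_sym; move: cr; rewrite /crossing A'E /prefix_lt !rev_cat.
  by have [-> ->] := H (rev P) (rev P').
have cmp' := cmp s sC nes.
apply: (glue Pi Qi P'i Q'i _ cmp'); first exact: (routes_compatible maxC).
move=> A B sE Ai Bi; apply/negP=> cr.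
have n1 : ~~ crossing P Q A B.
  by apply/negP=> /(crossing_conflict inn Pi Qi Ai Bi); rewrite -sE; apply: (routes_compatible maxC).
have n2 : ~~ crossing P' Q' A B.
  by apply/negP=> /(crossing_conflict inn P'i Q'i Ai Bi); rewrite -sE; apply: cmp'.
case/orP: x => /andP[x1 x2]; case/orP: cr => /andP[c1 c2].
- by case/negP: n1; rewrite /crossing c1 (suffix_trans c2 x2).
- by case/negP: n2; rewrite /crossing c2 (prefix_trans c1 x1) orbT.
- by case/negP: n2; rewrite /crossing c2 (prefix_trans x1 c1).
- by case/negP: n1; rewrite /crossing c1 (suffix_trans x2 c2) orbT.
Qed.

(** A common first edge would carry the conflict to its target, a later vertex; that vertex is
    inner, since otherwise both suffixes would end there and be equal. *)
Lemma last_conflict_head i P Q P' Q' : inner n i -> walk 1 P i -> walk i Q n ->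
  walk 1 P' i -> walk i Q' n -> prefix_lt P' P -> suffix_lt Q Q' ->
  (forall j, i < j -> ~ conflict_at j (P ++ Q) (P' ++ Q')) ->
  exists e f B B', [/\ Q = e :: B, Q' = f :: B', slack e & ~~ slack f].
Proof.
move=> inn Pi + P'i; have iN : i == n = false by move: inn; rewrite /inner; lia.
case: Q Q' => [|e B] [|f B'] //=; rewrite ?iN //.
move=> /andP[/eqP ei Bn] /andP[/eqP fi B'n] PP'.
rewrite suffix_cons; have [ef|nef] := eqVneq e f; last first.
  by move=> /and3P[_ se nsf] _; exists e, f, B, B'.
move=> BB' last; rewrite -ef in B'n last.
have tn : etgt e != n.
  apply/eqP=> tn; move: Bn B'n BB'; rewrite tn => /walk_nil-> /walk_nil->.
  by rewrite suffix_irr.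
case: (last (etgt e)); first by rewrite -ei esrc_lt_etgt.
rewrite -!cat_rcons; apply: crossing_conflict; rewrite ?walk_rcons ?ei ?eqxx ?andbT //.
  by move: inn (etgt_le e) tn (esrc_lt_etgt e); rewrite ei /inner; lia.
by rewrite /crossing !prefix_rcons eqxx PP' BB' orbT.
Qed.

Lemma is_xE k e : is_x k e = slack e && (esrc e == k).
Proof. by case: e. Qed.

Lemma is_yE k e : 1 < k -> is_y k e = ~~ slack e && (esrc e == k).
Proof. by case: e => a //= k1; have [->|] := eqVneq (a : nat) 0; lia. Qed.

(** * Local shape of the two exchanged routes *)

Section Flip.
Context (C C' : {set edge_seq n}) (maxC : maximal_clique C) (maxC' : maximal_clique C').
Context (i : nat) (P P' B B' : seq (edge n)) (e f : edge n).
Hypothesis inn : inner n i.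
Hypothesis se : slack e.
Hypothesis nsf : ~~ slack f.
Hypothesis PP' : prefix_lt P' P.
Hypothesis thr : through C i P (e :: B).
Hypothesis thr' : through C' i P' (f :: B').
Hypothesis CC' : forall t, t \in routes C -> t <> P ++ e :: B -> t \in routes C'.
Hypothesis C'C : forall t, t \in routes C' -> t <> P' ++ f :: B' -> t \in routes C.
Hypothesis last_conflict :
  forall j, i < j -> ~ conflict_at j (P ++ e :: B) (P' ++ f :: B').

Let ei : esrc e = i.
Proof. by case/and3P: thr => _ _ /= /andP[/eqP]. Qed.
Let fi : esrc f = i.
Proof. by case/and3P: thr' => _ _ /= /andP[/eqP]. Qed.
Let te : etgt e = i.+1.
Proof. by rewrite etgt_slack // ei. Qed.
Let tf : etgt f = minn n i.+2.
Proof. by rewrite etgt_nslack // fi //; case/andP: inn. Qed.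
Let ef Z Z' : suffix_lt (e :: Z) (f :: Z').
Proof. by apply: suffix_slack; rewrite ?ei ?fi. Qed.
Let nPP' : P <> P'.
Proof. by move=> eqP; move: PP'; rewrite eqP prefix_irr. Qed.

Let through_CC' v A Z : through C v A Z -> A ++ Z <> P ++ e :: B -> through C' v A Z.
Proof. by case/and3P=> AZ Av Zv ne; rewrite /through CC' ?Av. Qed.
Let through_C'C v A Z : through C' v A Z -> A ++ Z <> P' ++ f :: B' -> through C v A Z.
Proof. by case/and3P=> AZ Av Zv ne; rewrite /through C'C ?Av. Qed.

Lemma flip_exchange : through C i P (f :: B').
Proof.
have /and3P[_ P'i fB'i] := thr'.
apply: (resolvent maxC inn thr P'i fB'i) => //; first by rewrite /crossing PP' ef orbT.
by move=> t tC /(CC' tC); apply: (routes_compatible maxC'); case/and3P: thr'.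
Qed.

Lemma flip_exchange' : through C' i P' (e :: B).
Proof.
have /and3P[_ Pi eBi] := thr.
apply: (resolvent maxC' inn thr' Pi eBi) => //; first by rewrite /crossing PP' ef.
  by move=> t tC /(C'C tC); apply: (routes_compatible maxC); case/and3P: thr.
by move=> j ij /conflict_sym; apply: last_conflict.
Qed.

Let thPf' : through C' i P (f :: B').
Proof.
apply: through_CC' flip_exchange _ => eq.
have /and3P[_ Pi _] := thr; have [_ [fe _]] := cat_walk_eq eq Pi Pi.
by move: nsf; rewrite fe se.
Qed.
Let thP'e : through C i P' (e :: B).
Proof.
apply: through_C'C flip_exchange' _ => eq.
have /and3P[_ P'i _] := thr'; have [_ [fe _]] := cat_walk_eq eq P'i P'i.
by move: nsf; rewrite -fe se.
Qed.

(** A second such route would survive in [C'], where [P] would then extend along both edges, as [P']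
    already does. *)
Lemma flip_only Z : through C i P (e :: Z) -> Z = B.
Proof.
move=> th; have [//|/eqP ne] := eqVneq Z B.
have th' : through C' i P (e :: Z).
  apply: through_CC' th _ => eq; apply: ne.
  by have /and3P[_ Pi _] := thr; have [_ [->]] := cat_walk_eq eq Pi Pi.
by case: nPP'; apply: (common_prefix_unique maxC' inn ei se fi nsf th' thPf' flip_exchange' thr').
Qed.

Lemma flip_only' Z : through C' i P' (f :: Z) -> Z = B'.
Proof.
move=> th; have [//|/eqP ne] := eqVneq Z B'.
have th' : through C i P' (f :: Z).
  apply: through_C'C th _ => eq; apply: ne.
  by have /and3P[_ Pi _] := thr'; have [_ [->]] := cat_walk_eq eq Pi Pi.
by case: nPP'; apply: (common_prefix_unique maxC inn ei se fi nsf thr flip_exchange thP'e th').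
Qed.

(** Slack edges come last among incoming ones, and a prefix after [P] followed by [e] would cross
    [P ++ f :: B']. *)
Let Pe_max A Z : through C i.+1 A Z -> ~~ prefix_lt (rcons P e) A.
Proof.
case/lastP: A => [|A g]; first by case/and3P=> _ /eqP[i0] _; move: inn; rewrite /inner -i0.
rewrite through_rcons prefix_rcons => /andP[tg th].
have [eg|_] := eqVneq e g; last by rewrite /in_lt se andbF.
apply/negP=> PA; rewrite -eg ei in th.
by have := through_not_crossing maxC inn flip_exchange th; rewrite /crossing PA ef.
Qed.

Let P'f_min A Z : inner n i.+2 -> through C' i.+2 A Z -> ~~ prefix_lt A (rcons P' f).
Proof.
move=> inn2; case/lastP: A => [|A g]; first by case/and3P.
rewrite through_rcons prefix_rcons => /andP[tg th].
have [gf|_] := eqVneq g f; last by rewrite /in_lt (negPf nsf) !andbF.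
apply/negP=> AP; rewrite gf fi in th.
by have := through_not_crossing maxC' inn flip_exchange' th; rewrite /crossing AP ef orbT.
Qed.

Let thPe : through C i.+1 (rcons P e) B.
Proof. by rewrite through_rcons te eqxx ei. Qed.
Let thP'f : inner n i.+2 -> through C' i.+2 (rcons P' f) B'.
Proof.
move=> inn2; rewrite through_rcons fi thr' tf andbT; apply/eqP/minn_idPr.
by case/andP: inn2 => _ /ltnW.
Qed.

(** If [B] started with the slack edge, the common prefix at [i.+1] would differ from [rcons P e],
    which has a single continuation, and so precede it; its nonslack continuation would then cross
    the route through [rcons P e]. *)
Lemma flip_second : inner n i.+1 ->
  exists f1 B1, [/\ B = f1 :: B1, ~~ slack f1 & esrc f1 = i.+1].
Proof.
move=> inn1; have lt1 : i.+1 < n by case/andP: inn1.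
have := thPe; case EB: B => [|f1 B1] th.
  by case/and3P: th => _ _ /eqP iN; rewrite iN ltnn in lt1.
have /and3P[_ Pe1 /= /andP[/eqP fi1 _]] := th; exists f1, B1; split=> //.
apply/negP=> sf1; have [|g nsg gi] := @exists_nslack i.+1; first exact: lt1.
have [A [Z [Z' [thA thA']]]] := common_prefix maxC inn1 fi1 sf1 gi nsg.
have neA : A <> rcons P e.
  move=> eqA; rewrite eqA !through_rcons ei in thA thA'.
  have /andP[_ /flip_only eZ] := thA; have /andP[_ /flip_only] := thA'.
  by rewrite -eZ => -[gf _]; rewrite gf sf1 in nsg.
have /and3P[_ A1 _] := thA.
have /orP[lt|lt] := prefix_total lt1 A1 Pe1 neA.
  have := through_not_crossing maxC inn1 thA' th.
  by rewrite /crossing lt (@suffix_slack f1 g) ?fi1 ?gi.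
by have := Pe_max thA; rewrite lt.
Qed.

Lemma flip_second' : inner n i.+2 ->
  exists e1 B1, [/\ B' = e1 :: B1, slack e1 & esrc e1 = i.+2].
Proof.
move=> inn2; have lt2 : i.+2 < n by case/andP: inn2.
have := thP'f inn2; case EB: B' => [|e1 B1] th.
  by case/and3P: th => _ _ /eqP iN; rewrite iN ltnn in lt2.
have /and3P[_ P'f2 /= /andP[/eqP ei2 _]] := th; exists e1, B1; split=> //.
apply: contraT => nse1; have [|g sg gi] := @exists_slack i.+2; first exact: lt2.
have [A [Z [Z' [thA thA']]]] := common_prefix maxC' inn2 gi sg ei2 nse1.
have neA : A <> rcons P' f.
  move=> eqA; rewrite eqA !through_rcons fi in thA thA'.
  have /andP[_ /flip_only' eZ] := thA; have /andP[_ /flip_only'] := thA'.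
  by rewrite -eZ => -[gf _]; rewrite gf sg in nse1.
have /and3P[_ A2 _] := thA.
have /orP[lt|lt] := prefix_total lt2 A2 P'f2 neA.
  by have := P'f_min inn2 thA; rewrite lt.
have := through_not_crossing maxC' inn2 th thA.
by rewrite /crossing lt (@suffix_slack g e1) ?ei2 ?gi.
Qed.

(** Continuing either route by [Qm] from [i.+3] on creates no crossing, so the result lies in the
    respective clique; uniqueness of the continuation after [P] and [e], or after [P'] and [f],
    identifies the tail with [Qm]. *)
Lemma flip_tails e1 f1 B1 B1' : inner n i.+3 -> B = f1 :: B1 -> ~~ slack f1 ->
  B' = e1 :: B1' -> slack e1 -> B1 = B1'.
Proof.
move=> inn3 BE nsf1 B'E se1.
have lt3 : i.+3 < n by case/andP: inn3.
have inn2 : inner n i.+2 by apply/andP; split=> //; exact: ltnW.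
have fi1 : esrc f1 = i.+1 by have /and3P[_ _] := thPe; rewrite BE /= => /andP[/eqP].
have ei2 : esrc e1 = i.+2 by have /and3P[_ _] := thP'f inn2; rewrite B'E /= => /andP[/eqP].
have tf1 : etgt f1 = i.+3 by rewrite etgt_nslack ?fi1 //; [exact/minn_idPr/ltnW | case/andP: inn => /ltnW].
have te1 : etgt e1 = i.+3 by rewrite etgt_slack ?ei2.
have thr3 : through C i.+3 (rcons (rcons P e) f1) B1.
  by rewrite through_rcons tf1 eqxx fi1 -BE thPe.
have thr3' : through C' i.+3 (rcons (rcons P' f) e1) B1'.
  by rewrite through_rcons te1 eqxx ei2 -B'E thP'f.
have nef1 : f1 == e1 = false by apply/eqP=> eq; rewrite eq se1 in nsf1.
have [A [Z]] := edge_used maxC e1; rewrite ei2 => thA.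
have thA3 : through C i.+3 (rcons A e1) Z by rewrite through_rcons te1 eqxx ei2.
(* The default [f1] of [last] differs from [e1], so an empty prefix is not selected. *)
have [||||U [Qm [thU Ue minQ]]] := @through_extremal C i.+3 (fun a b => suffix_lt b.2 a.2)
    (fun a => last f1 a.1 == e1) (rcons A e1) Z _ _ _ _ => //.
- by move=> a; rewrite /= suffix_irr.
- by move=> b a c ab bc; apply: suffix_trans bc ab.
- by rewrite /= last_rcons.
clear A Z thA thA3.
have {}minQ A Z : through C i.+3 A Z -> last f1 A = e1 -> ~~ suffix_lt Z Qm.
  by move=> th /eqP; apply: minQ th.
case/lastP: U thU Ue => [|U g]; first by rewrite /= nef1.
move=> thU; rewrite /= last_rcons => /eqP eqg; rewrite {g}eqg in thU.
have /and3P[_ U3 Qm3] := thU; have /and3P[_ Z3 B13] := thr3.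
have /and3P[_ Z3' _] := thr3'.
have thU' : through C' i.+3 (rcons U e1) Qm.
  apply: through_CC' thU _ => eq.
  have eq' : rcons U e1 ++ Qm = rcons (rcons P e) f1 ++ B1 by rewrite eq BE !cat_rcons.
  have [/rcons_inj[_ ef1] _] := cat_walk_eq eq' U3 Z3.
  by rewrite ef1 eqxx in nef1.
have ZU : prefix_lt (rcons (rcons P e) f1) (rcons U e1).
  by apply: prefix_slack; rewrite ?tf1 ?te1.
have -> : B1 = Qm.
  have /flip_only : through C i P (e :: f1 :: Qm); last by rewrite BE => -[].
  suff : through C i.+3 (rcons (rcons P e) f1) Qm.
    by rewrite !through_rcons fi1 ei => /andP[_ /andP[_]].
  apply: (through_glue maxC thr3 thU) => A Z thA; apply/negP=> /orP[]/andP[].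
    case/lastP: A thA => [|A g] thA; first by case/and3P: thA.
    rewrite prefix_rcons; have [fg|_] := eqVneq f1 g.
      move: thA; rewrite through_rcons -fg fi1 => /andP[_ /Pe_max/negPf->].
      by [].
    case/and3P=> /eqP tg _ sg; have ge : g = e1.
      by apply: edge_tgt_inj; rewrite -?tg ?tf1 ?te1 ?sg ?se1.
    by apply/negP; apply: (minQ _ _ thA); rewrite /= last_rcons ge.
  (* [B1] cannot come after [Qm], because its prefix precedes [rcons U e1]; a suffix after [Qm] is
     thus also after [B1]. *)
  move=> AZ QZ; have := through_not_crossing maxC inn3 thA thr3.
  have := through_not_crossing maxC inn3 thr3 thU; rewrite /crossing ZU AZ /=.
  rewrite !negb_or => /andP[nQB _] /andP[nBZ _].
  have [QB|/eqP nQB1] := eqVneq Qm B1; first by rewrite -QB QZ in nBZ.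
  have /orP[QB|BQ] := suffix_total (isT : 1 < i.+3) Qm3 B13 nQB1.
    by rewrite QB in nQB.
  by rewrite (suffix_trans BQ QZ) in nBZ.
have /flip_only' : through C' i P' (f :: e1 :: Qm); last by rewrite B'E => -[].
suff : through C' i.+3 (rcons (rcons P' f) e1) Qm.
  by rewrite !through_rcons ei2 fi => /andP[_ /andP[_]].
apply: (through_glue maxC' thr3' thU') => A Z thA; apply/negP=> /orP[]/andP[].
  case/lastP: A thA => [|A g] thA; first by case/and3P: thA.
  rewrite prefix_rcons; have [eg|_] := eqVneq e1 g; last by rewrite /in_lt se1 andbF.
  move=> lt; apply/negP; apply: (minQ (rcons A g)); last by rewrite last_rcons.
  apply: (through_C'C thA) => eq.
  have eq' : rcons A g ++ Z = rcons (rcons P' f) e1 ++ B1' by rewrite eq B'E !cat_rcons.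
  have /and3P[_ A3 _] := thA; have [/rcons_inj[AP _] _] := cat_walk_eq eq' A3 Z3'.
  by rewrite AP prefix_irr in lt.
move=> AZ QZ; have := through_not_crossing maxC' inn3 thA thU'.
(* Since [rcons P' f] is first at [i.+2], a prefix before [rcons (rcons P' f) e1] is also before
   [rcons U e1]. *)
suff -> : crossing A Z (rcons U e1) Qm by [].
rewrite /crossing QZ andbT; apply/orP; left.
have [<-//|/eqP nZU] := eqVneq (rcons (rcons P' f) e1) (rcons U e1).
have /orP[lt|] := prefix_total lt3 Z3' U3 nZU; first exact: prefix_trans lt.
rewrite prefix_rcons eqxx => lt; move: thU'; rewrite through_rcons ei2 => /andP[_].
by move/(P'f_min inn2); rewrite lt.
Qed.

Lemma flip_edges g :
  (g \in f :: B') + is_x i g + is_y i.+1 g = (g \in e :: B) + is_x i.+2 g + is_y i g.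
Proof.
have [i1 ltin] := andP inn.
have srcE h : esrc h = esrc g -> 1 < esrc h -> (g == h) = (slack h == slack g).
  move=> hg h1; apply/eqP/eqP=> [->//|sl]; exact/esym/edge_src_inj.
(* No edge leaves a vertex from [n] on: this kills the terms of nonexistent edges when the routes
   end early. *)
have out k : n <= k -> (esrc g == k) = false.
  move=> nk; apply: ltn_eqF; apply: leq_trans nk.
  exact: leq_trans (esrc_lt_etgt g) (etgt_le g).
have memE h k : esrc h = k -> 1 < k -> (g == h) = (slack h == slack g) && (esrc g == k).
  move=> <- h1; have [eq|ne] := eqVneq (esrc g) (esrc h); first by rewrite andbT srcE.
  by rewrite andbF; apply: contraNF ne => /eqP->.
rewrite !is_xE !is_yE ?inE // ?ltnS ?(ltnW i1) //.
rewrite (memE e i) // (memE f i) // se (negPf nsf).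
have /and3P[_ _ Bn] := thPe.
have [in1|] := ltnP i.+1 n; last first.
  move=> le; have iN : i.+1 = n by apply/eqP; rewrite eqn_leq ltin.
  rewrite iN in Bn; have -> : B = [::] := walk_nil Bn.
  have /and3P[_ _ /= /andP[_]] := thr'; rewrite tf (minn_idPl (leqW le)) => /walk_nil ->.
  rewrite (out i.+1 le) (out i.+2 (leqW le)) !andbF !in_nil !orbF.
  by case: (slack g); case: (esrc g == i).
have [|f1 [B1 [BE nsf1 fi1]]] := flip_second; first by rewrite /inner in1 ltnS ltnW.
have tf1 : etgt f1 = minn n i.+3 by rewrite etgt_nslack ?fi1 // ltnS ltnW.
rewrite BE inE (memE f1 i.+1) // ?(negPf nsf1) ?ltnS ?(ltnW i1) //.
move: Bn; rewrite BE /= tf1 => /andP[_ B1n].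
have [in2|] := ltnP i.+2 n; last first.
  move=> le.
  have /and3P[_ _ /= /andP[_]] := thr'; rewrite tf (minn_idPl le) => /walk_nil ->.
  move: B1n; rewrite (minn_idPl (leqW le)) => /walk_nil ->.
  rewrite (out i.+2 le) !andbF !in_nil !orbF.
  by case: (slack g); case: (esrc g == i); case: (esrc g == i.+1).
have inn2 : inner n i.+2 by apply/andP.
have [e1 [B1' [B'E se1 ei2]]] := flip_second' inn2.
rewrite B'E inE (memE e1 i.+2) // se1.
move: B1n; rewrite (minn_idPr in2) => B1n.
have <- : B1 = B1'.
  have [in3|le] := ltnP i.+3 n.
    by apply: (@flip_tails e1 f1) => //; apply/andP.
  have i3 : i.+3 = n by apply/eqP; rewrite eqn_leq in2.
  have /and3P[_ _] := thP'f inn2.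
  rewrite B'E /= (etgt_slack se1) ei2 i3 => /andP[_ /walk_nil ->].
  by move: B1n; rewrite i3 => /walk_nil.
have [gB|_] := boolP (g \in B1).
  have ne k : k < i.+3 -> (esrc g == k) = false.
    by move=> lt; apply/gtn_eqF/(leq_trans lt)/(walk_mem_src B1n gB).
  by rewrite (ne i) ?(ne i.+1) ?(ne i.+2) ?andbF // ltnS leqW.
by case: (slack g); case: (esrc g == i); case: (esrc g == i.+1); case: (esrc g == i.+2).
Qed.

End Flip.

(** * Integer flows *)

Definition starts (C : {set edge_seq n}) e : {set edge_seq n} :=
  [set A : edge_seq n | prefix_at (esrc e) A && [exists r in C, prefix (rcons A e) r]].

Lemma startsP C e (A : edge_seq n) :
  reflect (walk 1 A (esrc e) /\ exists Z, val A ++ e :: Z \in routes C) (A \in starts C e).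
Proof.
rewrite inE; apply: (iffP andP) => -[Ae].
  case/existsP=> r /andP[rC /prefixP[Z rE]]; split=> //; exists Z.
  by rewrite -cat_rcons -rE mem_routes.
case=> Z /routesP[r rC rE]; split=> //; apply/existsP; exists r; rewrite rC /=.
by apply/prefixP; exists Z; rewrite cat_rcons.
Qed.

Lemma flow_ofE C e :
  flow_of C e = if esrc e == 1 then 0%R else (#|starts C e|%:Z - 1)%R.
Proof. by rewrite ffunE; case: ifP => // _; rewrite /starts cardsE. Qed.

Lemma starts_through C e (A : edge_seq n) : maximal_clique C ->
  reflect (exists Z, through C (esrc e) A (e :: Z)) (A \in starts C e).
Proof.
move=> maxC; apply: (iffP (startsP _ _ _)) => [[Ae [Z AZ]]|[Z /and3P[AZ Ae _]]].
  exists Z; rewrite /through AZ Ae -(walk_catE _ _ Ae).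
  exact: (routes_walk maxC).
by split=> //; exists Z.
Qed.

Definition prefixes (C : {set edge_seq n}) i : {set edge_seq n} :=
  [set A : edge_seq n | `[< exists Z, through C i A Z >]].

Lemma prefixesP C i (A : edge_seq n) :
  reflect (exists Z, through C i A Z) (A \in prefixes C i).
Proof. by rewrite inE; apply: asboolP. Qed.

Lemma walk_bseq p i : walk 1 p i -> i <= n -> exists A : edge_seq n, val A = p.
Proof.
move=> pi lein; have szp : size p <= n by have := walk_size pi; lia.
by exists (Bseq szp).
Qed.

(** Only the empty prefix reaches vertex 1, so the count minus one gives the prescribed value zero,
    and the case distinction in [flow_of] disappears. *)
Lemma card_starts_source C e : maximal_clique C -> esrc e = 1 -> #|starts C e| = 1.
Proof.
move=> maxC e1; have [A [Z thA]] := edge_used maxC e.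
have /and3P[_ Ae _] := thA; have A0 : A = [::] by apply: (@walk_nil 1); rewrite -{2}e1.
have [A' A'E] := walk_bseq Ae (ltnW (leq_trans (esrc_lt_etgt e) (etgt_le e))).
rewrite (_ : starts C e = [set A']) ?cards1 //; apply/setP=> P; rewrite finset.in_set1.
apply/(starts_through _ _ maxC)/eqP=> [[Z' /and3P[_ Pe _]]|->]; last by exists Z; rewrite A'E.
by apply: val_inj; rewrite A'E A0; apply: (@walk_nil 1); rewrite -{2}e1.
Qed.

(** The two sets cover all prefixes at [i] and overlap in the common prefix only; this surplus of
    one is the netflow at [i]. *)
Lemma card_starts_out C i e f : maximal_clique C -> inner n i ->
  esrc e = i -> slack e -> esrc f = i -> ~~ slack f ->
  #|starts C e| + #|starts C f| = #|prefixes C i|.+1.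
Proof.
move=> maxC inn ei se fi nsf; have [i1 lti] := andP inn.
have [P [B [B' [thB thB']]]] := common_prefix maxC inn ei se fi nsf.
have /and3P[_ Pi _] := thB; have [P0 P0E] := walk_bseq Pi (ltnW lti).
rewrite -cardsUI -addn1; congr addn.
  apply: eq_card => A; rewrite finset.in_setU; apply/orP/prefixesP=> [[]/(starts_through _ _ maxC)[Z]|[[|g Z] thA]].
  - by rewrite ei; exists (e :: Z).
  - by rewrite fi; exists (f :: Z).
  - by case/and3P: thA => _ _ /eqP iN; rewrite iN ltnn in lti.
  have gi : esrc g = i by case/and3P: thA => _ _ /andP[/eqP].
  have [sg|nsg] := boolP (slack g); [left|right]; apply/(starts_through _ _ maxC).
    by exists Z; rewrite (_ : e = g) ?gi //; apply: edge_src_inj; rewrite ?ei ?gi ?se.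
  exists Z; rewrite (_ : f = g) ?gi //; apply: edge_src_inj; rewrite ?fi ?gi //.
  by rewrite (negPf nsf) (negPf nsg).
rewrite -(cards1 P0); apply: eq_card => A; rewrite finset.in_setI finset.in_set1.
apply/andP/eqP=> [[/(starts_through _ _ maxC)[Z thA] /(starts_through _ _ maxC)[Z' thA']]|->].
  rewrite ei in thA; rewrite fi in thA'; apply: val_inj; rewrite P0E.
  exact: (common_prefix_unique maxC inn ei se fi nsf thA thA' thB thB').
by split; apply/(starts_through _ _ maxC); rewrite P0E ?ei ?fi; [exists B|exists B'].
Qed.

(** Appending an edge is injective, and the last edge tells the two images apart. *)
Lemma card_starts_in C i e f : maximal_clique C -> inner n i ->
  etgt e = i -> slack e -> etgt f = i -> ~~ slack f ->
  #|starts C e| + #|starts C f| = #|prefixes C i|.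
Proof.
move=> maxC inn ei se fi nsf; have [i1 lti] := andP inn.
pose ext (g : edge n) (A : edge_seq n) : edge_seq n := insub_bseq n (rcons A g).
have extE g (A : edge_seq n) : A \in starts C g -> val (ext g A) = rcons A g.
  case/startsP=> Ag _; rewrite /ext /insub_bseq insubdK // /in_mem /= size_rcons.
  by have := walk_size Ag; have := esrc_lt_etgt g; have := etgt_le g; lia.
have ext_inj g : {in starts C g &, injective (ext g)}.
  move=> A A' sA sA' /(congr1 val); rewrite !extE // => /rcons_inj[AA'].
  exact: val_inj.
rewrite -(card_in_imset (@ext_inj e)) -(card_in_imset (@ext_inj f)) -cardsUI.
rewrite (_ : _ :&: _ = finset.set0) ?cards0 ?addn0; last first.
  apply/setP=> A; rewrite finset.in_setI finset.in_set0; apply/negP=> /andP[].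
  case/imsetP=> A1 sA1 -> /imsetP[A2 sA2] /(congr1 val); rewrite !extE //.
  by case/rcons_inj=> _ ef; rewrite -ef se in nsf.
apply: eq_card => A; rewrite finset.in_setU; apply/orP/prefixesP=> [[]/imsetP[A1 sA1 ->]|[Z]].
- rewrite extE //; have [Z thA] := starts_through _ _ maxC sA1.
  by exists Z; rewrite through_rcons ei eqxx.
- rewrite extE //; have [Z thA] := starts_through _ _ maxC sA1.
  by exists Z; rewrite through_rcons fi eqxx.
have [s sE] : exists s, s = val A by exists (val A).
case/lastP: s sE => [|p g] AE.
  by rewrite -AE => /and3P[_ /eqP i1' _]; rewrite -i1' in i1.
rewrite -AE through_rcons => /andP[/eqP gi thp].
have /and3P[_ pg _] := thp.
have [p' p'E] := walk_bseq pg (ltnW (leq_trans (esrc_lt_etgt g) (etgt_le g))).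
have sp' : p' \in starts C g by apply/(starts_through _ _ maxC); exists Z; rewrite p'E.
have AEg : A = ext g p' by apply: val_inj; rewrite extE // p'E AE.
have [sg|nsg] := boolP (slack g); [left|right]; apply/imsetP; exists p' => //.
- by rewrite (_ : e = g) //; apply: edge_tgt_inj; rewrite ?ei ?gi ?se.
- by rewrite (_ : e = g) //; apply: edge_tgt_inj; rewrite ?ei ?gi ?se.
- rewrite (_ : f = g) //; apply: edge_tgt_inj; rewrite ?fi ?gi //.
  by rewrite (negPf nsf) (negPf nsg).
- rewrite (_ : f = g) //; apply: edge_tgt_inj; rewrite ?fi ?gi //.
  by rewrite (negPf nsf) (negPf nsg).
Qed.

Lemma flow_of_starts C e : maximal_clique C -> flow_of C e = (#|starts C e|%:Z - 1)%R.
Proof.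
by move=> maxC; rewrite flow_ofE; case: eqP => // e1; rewrite card_starts_source.
Qed.

Lemma flow_of_ge0 C e : maximal_clique C -> (0 <= flow_of C e)%R.
Proof.
move=> maxC; rewrite flow_of_starts //.
have [A [Z thA]] := edge_used maxC e; have /and3P[_ Ae _] := thA.
have [A' A'E] := walk_bseq Ae (ltnW (leq_trans (esrc_lt_etgt e) (etgt_le e))).
have : A' \in starts C e by apply/(starts_through _ _ maxC); exists Z; rewrite A'E.
by move=> sA; have : 0 < #|starts C e|; [apply/card_gt0P; exists A' | lia].
Qed.

Lemma sum_src (F : edge n -> int) e f : 1 < esrc e -> esrc f = esrc e ->
  slack e -> ~~ slack f -> (\sum_(g | esrc g == esrc e) F g = F e + F f)%R.
Proof.
move=> e1 fe se nsf; have nfe : f != e by apply: contraNneq nsf => ->.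
rewrite (bigD1 e) //= (bigD1 f) /= ?fe ?eqxx // big_pred0 ?GRing.addr0 // => g.
apply/negP=> /andP[/andP[/eqP ge /eqP nge] /eqP ngf].
have [sg|nsg] := boolP (slack g).
  by apply: nge; apply: edge_src_inj; rewrite ?ge ?sg.
by apply: ngf; apply: edge_src_inj; rewrite ?ge ?fe // (negPf nsg) (negPf nsf).
Qed.

Lemma sum_tgt (F : edge n -> int) e f : etgt e < n -> etgt f = etgt e ->
  slack e -> ~~ slack f -> (\sum_(g | etgt g == etgt e) F g = F e + F f)%R.
Proof.
move=> e1 fe se nsf; have nfe : f != e by apply: contraNneq nsf => ->.
rewrite (bigD1 e) //= (bigD1 f) /= ?fe ?eqxx // big_pred0 ?GRing.addr0 // => g.
apply/negP=> /andP[/andP[/eqP ge /eqP nge] /eqP ngf].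
have [sg|nsg] := boolP (slack g).
  by apply: nge; apply: edge_tgt_inj; rewrite ?ge ?sg.
by apply: ngf; apply: edge_tgt_inj; rewrite ?ge ?fe // (negPf nsg) (negPf nsf).
Qed.

Lemma exists_nslack_tgt i : inner n i -> exists2 e : edge n, ~~ slack e & etgt e = i.
Proof.
case/andP=> i1 lti; have lt2 : i.-2 < n by lia.
by exists (inr (Ordinal lt2)) => //=; case: eqP; lia.
Qed.

Lemma flow_of_inner C i : maximal_clique C -> inner n i ->
  (\sum_(e | etgt e == i) flow_of C e + 1 = \sum_(e | esrc e == i) flow_of C e)%R.
Proof.
move=> maxC inn; have [i1 lti] := andP inn.
have [|e se ei] := @exists_slack i; first by rewrite lti ltnW.
have [|f nsf fi] := @exists_nslack i; first by rewrite lti ltnW.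
have [|g sg gi] := @exists_slack i.-1; first lia.
have tg : etgt g = i by rewrite etgt_slack // gi; lia.
have [h nsh th] := exists_nslack_tgt inn.
have := card_starts_out maxC inn ei se fi nsf.
have := card_starts_in maxC inn tg sg th nsh.
have -> : (\sum_(e | etgt e == i) flow_of C e = flow_of C g + flow_of C h)%R.
  by rewrite -tg; apply: sum_tgt; rewrite ?tg.
have -> : (\sum_(e | esrc e == i) flow_of C e = flow_of C e + flow_of C f)%R.
  by rewrite -ei; apply: sum_src; rewrite ?ei.
rewrite !flow_of_starts //; lia.
Qed.

Lemma sum_src_edges (F : edge n -> int) :
  (\sum_(j < n.+1) \sum_(e | esrc e == j) F e = \sum_e F e)%R.
Proof.
rewrite [RHS](partition_big (fun e => inord (esrc e) : 'I_n.+1) predT) //=.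
apply: eq_bigr => j _; apply: eq_bigl => e; rewrite -val_eqE /= inordK //.
by have := esrc_lt_etgt e; have := etgt_le e; lia.
Qed.

Lemma sum_tgt_edges (F : edge n -> int) :
  (\sum_(j < n.+1) \sum_(e | etgt e == j) F e = \sum_e F e)%R.
Proof.
rewrite [RHS](partition_big (fun e => inord (etgt e) : 'I_n.+1) predT) //=.
apply: eq_bigr => j _; apply: eq_bigl => e; rewrite -val_eqE /= inordK //.
by rewrite ltnS etgt_le.
Qed.

(* Conservation at [n] follows from conservation elsewhere, since the total inflow
   and the total outflow over all vertices agree. *)
Lemma int_flow_of C : maximal_clique C -> int_flow (flow_of C).
Proof.
move=> maxC; split=> [e|]; first exact: flow_of_ge0.
pose inflow j : int := (\sum_(e : edge n | etgt e == j) flow_of C e)%R.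
pose outflow j : int := (\sum_(e : edge n | esrc e == j) flow_of C e)%R.
have in_small j : j <= 1 -> inflow j = 0%R.
  move=> j1; apply: big_pred0 => e; apply/negP=> /eqP ej.
  by have := esrc_lt_etgt e; have := esrc_gt0 e; lia.
have out_small j : j <= 1 -> outflow j = 0%R.
  move=> j1; apply: big1 => e /eqP ej; rewrite flow_ofE.
  by have := esrc_gt0 e; case: eqP => //; lia.
have out_n : outflow n = 0%R.
  apply: big_pred0 => e; apply/negP=> /eqP ej.
  by have := esrc_lt_etgt e; have := etgt_le e; lia.
(* The truncated [m - 2] counts the inner vertices below [m], none when [m] is at most 2. *)
have partial m : m <= n ->
    (\sum_(j < m) outflow j = \sum_(j < m) inflow j + (m - 2)%N%:Z)%R.
  elim: m => [|m IH] mn; first by rewrite !big_ord0.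
  rewrite !big_ord_recr /= IH 1?ltnW //; have [m1|m1] := leqP m 1.
    rewrite in_small // out_small // !GRing.addr0; congr (_ + Posz _)%R; lia.
  have /(_ C m maxC) := flow_of_inner; rewrite /inner m1 mn => /(_ isT).
  rewrite -/(inflow m) -/(outflow m) => <-; rewrite GRing.addrACA; congr (_ + _)%R.
  by rewrite -PoszD addn1 subSn.
have inflow_n : inflow n = Posz (n - 2).
  have := etrans (sum_src_edges (flow_of C)) (esym (sum_tgt_edges (flow_of C))).
  rewrite !big_ord_recr /= -/(inflow n) -/(outflow n) out_n GRing.addr0.
  by rewrite -/(\sum_(j < n) outflow j)%R (partial n (leqnn n)) => /GRing.addrI <-.
move=> i /andP[i0 lein]; rewrite -/(inflow i) -/(outflow i) /netflow.
have [->|i1] := eqVneq i 1; first by rewrite in_small ?out_small.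
have [->|iN] := eqVneq i n.
  by rewrite out_n inflow_n -subzn ?GRing.subrr // ltnW.
by apply: flow_of_inner => //; rewrite /inner; lia.
Qed.

(** * Effect of removing a route on the flow *)

Lemma routes_setD1 C (r : edge_seq n) s :
  (s \in routes (C :\ r)) = (s != val r) && (s \in routes C).
Proof.
apply/idP/andP=> [/routesP[t]|[sr /routesP[t tC sE]]].
  by rewrite in_setD1 => /andP[tr tC] ->; rewrite mem_routes (inj_eq val_inj).
by rewrite sE mem_routes in_setD1 tC andbT; apply: contraNneq sr => <-; rewrite sE.
Qed.

(** The smaller clique is not maximal, but its [flow_of] serves as the common reference for the two
    flows being compared. *)
Lemma flow_remove C (r : edge_seq n) i P e B Z0 : maximal_clique C -> 1 < i -> val r = P ++ e :: B ->
  through C i P (e :: B) -> through C i P Z0 -> Z0 <> e :: B ->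
  (forall Z, through C i P (e :: Z) -> Z = B) ->
  forall g, flow_of C g = (flow_of (C :\ r) g + (g \in e :: B)%:Z)%R.
Proof.
move=> maxC i1 rE thr th0 ne only g; rewrite !flow_ofE.
have /and3P[_ Pi eBn] := thr; have /and3P[PZ0 _ _] := th0.
case: eqP => [g1|ng1].
  by have [/(walk_mem_src eBn)|//] := boolP (g \in _); rewrite g1 leqNgt i1.
suff -> : #|starts C g| = #|starts (C :\ r) g| + (g \in e :: B) by rewrite PoszD GRing.addrAC.
have sub (A : edge_seq n) : A \in starts (C :\ r) g -> A \in starts C g.
  case/startsP=> Ag [Z]; rewrite routes_setD1 => /andP[_ AZ]; apply/startsP.
  by split=> //; exists Z.
have [gB|ngB] := boolP (g \in e :: B); last first.
  rewrite addn0; apply: eq_card => A; apply/idP/idP; last exact: sub.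
  case/startsP=> Ag [Z AZ]; apply/startsP; split=> //.
  have [AZr|nAZr] := eqVneq (val A ++ g :: Z) (val r); last first.
    by exists Z; rewrite routes_setD1 nAZr.
  rewrite rE in AZr; have [ig|gi] := leqP i (esrc g).
    have [E [_ _ BE]] := cat_walk_le AZr Ag Pi ig.
    by case/negP: ngB; rewrite BE mem_cat mem_head orbT.
  have [[|g' E] [PE Ei gE]] := cat_walk_le (esym AZr) Pi Ag (ltnW gi).
    by move: Ei => /eqP gi'; rewrite gi' ltnn in gi.
  (* Here [g] lies on [P], and [P ++ Z0] keeps this prefix in use. *)
  case: gE => gg' _; exists (E ++ Z0); rewrite -cat_cons gg' catA -PE routes_setD1 PZ0 andbT.
  rewrite rE; apply/eqP=> eq; apply: ne.
  by have [] := cat_walk_eq eq Pi Pi.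
have [E [Z BE]] : exists E Z, e :: B = E ++ g :: Z.
  by case/splitPr: gB => E Z; exists E, Z.
have [w Ew] := walk_split (eq_ind _ (fun q => walk i q n) eBn _ BE).
move=> /andP[/eqP gw _]; rewrite -gw in Ew.
have PEg : walk 1 (P ++ E) (esrc g) by rewrite (walk_catE _ _ Pi).
have [A0 A0E] := walk_bseq PEg (ltnW (leq_trans (esrc_lt_etgt g) (etgt_le g))).
rewrite addn1 -add1n -[1]/(true : nat).
have <- : A0 \notin starts (C :\ r) g.
  apply/negP=> /startsP[_ [Z1]]; rewrite routes_setD1 A0E -catA => /andP[/eqP nr PEZ].
  have [Z2 eZ] : exists Z2, E ++ g :: Z1 = e :: Z2.
    case: (E) BE => [|e' E'] /= [-> _]; first by exists Z1.
    by exists (E' ++ g :: Z1).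
  apply: nr; rewrite rE eZ; congr (_ ++ _ :: _); apply: only.
  rewrite /through -eZ PEZ Pi /= -(walk_catE _ _ Pi); exact: (routes_walk maxC).
rewrite -cardsU1; apply: eq_card => A; rewrite finset.in_setU1.
apply/idP/predU1P=> [/startsP[Ag [Z1 AZ]]|[->|/sub//]]; last first.
  apply/startsP; split; first by move: PEg; rewrite -A0E.
  by exists Z; rewrite A0E -catA -BE; case/and3P: thr.
have [AZr|nAZr] := eqVneq (val A ++ g :: Z1) (val r); [left|right].
  rewrite rE BE catA in AZr; apply: val_inj; rewrite A0E.
  by have [] := cat_walk_eq AZr Ag PEg.
by apply/startsP; split=> //; exists Z1; rewrite routes_setD1 nAZr.
Qed.

(** * Recovering routes from convex hulls *)

Lemma route_sorted u p v : walk u p v -> sorted (fun e f : edge n => esrc e < esrc f) p.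
Proof.
elim: p u => //= e p IH u /andP[_ pv]; have := IH _ pv.
case: p pv {IH} => //= f p /andP[/eqP fe _] ->; rewrite andbT fe; exact: esrc_lt_etgt.
Qed.

(** Sources increase along a route, so the set of its edges fixes their order. *)
Lemma route_eq p q : walk 1 p n -> walk 1 q n -> p =i q -> p = q.
Proof.
move=> pn qn; apply: (@irr_sorted_eq _ (fun e f : edge n => esrc e < esrc f)).
- by move=> f e g; apply: ltn_trans.
- by move=> e; rewrite /= ltnn.
- exact: route_sorted pn.
- exact: route_sorted qn.
Qed.

(* Every route with a positive coefficient in a convex combination equal to a 0/1
   vector has that vector as its indicator. *)
Lemma simplex_subset (R : realType) (X Y : {set edge_seq n}) :
  (forall r, r \in X -> is_route r) -> (forall r, r \in Y -> is_route r) ->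
  simplex R X = simplex R Y -> X \subset Y.
Proof.
move=> rX rY eqS; apply/fintype.subsetP=> s sX.
have : simplex R X (indicator R s).
  exists (fun t => (t == s)%:R%R); split=> [t _||e]; first exact: Num.Theory.ler0n.
    by rewrite (bigD1 s) //= eqxx big1 ?GRing.addr0 // => t /andP[_ /negPf->].
  rewrite (bigD1 s) //= eqxx GRing.mul1r big1 ?GRing.addr0 // => t /andP[_ /negPf->].
  by rewrite GRing.mul0r.
rewrite eqS => -[lam [lam0 lam1 vE]].
have [t tY lt0] : exists2 t, t \in Y & lam t <> 0%R.
  apply: contrapT => no; suff : (\sum_(t in Y) lam t = 0)%R.
    by rewrite lam1 => /eqP; rewrite GRing.oner_eq0.
  apply: big1 => t tY; apply: contrapT => lt; apply: no; by exists t.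
rewrite (_ : s = t) //; apply/val_inj/route_eq; [exact: rX|exact: rY|] => e.
have := vE e; rewrite !ffunE; case: (boolP (e \in val s)) => es.
  move=> eq1; apply/esym; case: (boolP (e \in val t)) => [//|et]; case: lt0.
  (* Weighting by [1 - indicator] turns a coordinate equal to one into a vanishing sum of
     nonnegative terms. *)
  have sum0 : (\sum_(r in Y) lam r * (1 - indicator R r e) = 0)%R.
    under eq_bigr do rewrite GRing.mulrBr GRing.mulr1.
    by rewrite GRing.sumrB lam1 -eq1 GRing.subrr.
  have := Num.Theory.psumr_eq0P _ sum0 tY.
  rewrite ffunE (negPf et) GRing.subr0 GRing.mulr1; apply=> r rY'.
  rewrite Num.Theory.mulr_ge0 ?lam0 // ffunE.
  by case: (e \in _); rewrite ?GRing.subrr // GRing.subr0 Num.Theory.ler01.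
move/esym=> eq0; apply/esym/negP=> et; apply: lt0.
have := Num.Theory.psumr_eq0P _ eq0 tY; rewrite ffunE et GRing.mulr1; apply=> r rY'.
by rewrite Num.Theory.mulr_ge0 ?lam0 // ffunE Num.Theory.ler0n.
Qed.

(** * From exchanged routes to elementary moves *)

Lemma flip_flow C C' (r r' : edge_seq n) i P Q P' Q' :
  maximal_clique C -> maximal_clique C' -> r \in C -> r' \in C' -> C :\ r = C' :\ r' ->
  inner n i -> val r = P ++ Q -> val r' = P' ++ Q' ->
  walk 1 P i -> walk i Q n -> walk 1 P' i -> walk i Q' n ->
  prefix_lt P' P -> suffix_lt Q Q' ->
  (forall j, i < j -> ~ conflict_at j r r') ->
  forall g, (flow_of C' g + (is_x i g)%:Z + (is_y i.+1 g)%:Z =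
             flow_of C g + (is_x i.+2 g)%:Z + (is_y i g)%:Z)%R.
Proof.
move=> maxC maxC' rC r'C' CC' inn rE r'E Pi Qi P'i Q'i PP' QQ' last g.
change (forall j, i < j -> ~ conflict_at j (val r) (val r')) in last.
rewrite rE r'E in last.
have [e [f [B [B' [QE Q'E se nsf]]]]] := last_conflict_head inn Pi Qi P'i Q'i PP' QQ' last.
have thr : through C i P (e :: B) by rewrite /through -QE -rE mem_routes rC Pi.
have thr' : through C' i P' (f :: B') by rewrite /through -Q'E -r'E mem_routes r'C' P'i.
rewrite QE Q'E in rE r'E last.
have toC' t : t \in routes C -> t <> P ++ e :: B -> t \in routes C'.
  move=> tC /eqP tr; have : t \in routes (C' :\ r') by rewrite -CC' routes_setD1 tC rE tr.
  by rewrite routes_setD1 => /andP[].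
have toC t : t \in routes C' -> t <> P' ++ f :: B' -> t \in routes C.
  move=> tC /eqP tr; have : t \in routes (C :\ r) by rewrite CC' routes_setD1 tC r'E tr.
  by rewrite routes_setD1 => /andP[].
have nef : e <> f by move=> ef; rewrite -ef se in nsf.
have i1 : 1 < i by case/andP: inn.
have thPf := flip_exchange maxC maxC' inn se nsf PP' thr thr' toC' last.
have thP'e := flip_exchange' maxC maxC' inn se nsf PP' thr thr' toC last.
have only := flip_only maxC maxC' inn se nsf PP' thr thr' toC' toC last.
have only' := flip_only' maxC maxC' inn se nsf PP' thr thr' toC' toC last.
have neZ : f :: B' <> e :: B by case=> fe; case: nef.
rewrite (flow_remove maxC i1 rE thr thPf neZ only).
rewrite (flow_remove maxC' i1 r'E thr' thP'e (nesym neZ) only') CC'.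
have := flip_edges maxC maxC' inn se nsf PP' thr thr' toC' toC last g.
rewrite -!GRing.addrA -!PoszD => eq; congr (_ + Posz _)%R.
by rewrite !addnA.
Qed.

(** No edge is both lowered and raised, so nonnegativity after the move forces positivity before it,
    and applicability is automatic. The identity is symmetric, which gives the inverse move. *)
Lemma moves_of_flows (phi phi' : flow n) i : 1 < i ->
  (forall e, 0 <= phi e)%R -> (forall e, 0 <= phi' e)%R ->
  (forall g, phi' g + (is_x i g)%:Z + (is_y i.+1 g)%:Z =
             phi g + (is_x i.+2 g)%:Z + (is_y i g)%:Z)%R ->
  move_plus i phi = Some phi' /\ move_minus i phi' = Some phi.
Proof.
move=> i1 phi0 phi'0 eq.
have excl (g : edge n) : [/\ is_x i g -> ~~ is_x i.+2 g && ~~ is_y i g,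
    is_y i.+1 g -> ~~ is_x i.+2 g && ~~ is_y i g, is_x i.+2 g -> ~~ is_x i g && ~~ is_y i.+1 g
    & is_y i g -> ~~ is_x i g && ~~ is_y i.+1 g].
  by rewrite !is_xE !is_yE ?ltnS ?(ltnW i1) //; case: (slack g) => /=; split; lia.
have solve (a b x x' y y' : int) : (b + x + y' = a + x' + y ->
    a - x - y' + x' + y = b)%R by lia.
have pos (a b : int) (x x' y y' : bool) : (b + x%:Z + y'%:Z = a + x'%:Z + y%:Z)%R ->
    (0 <= b)%R -> x || y' -> ~~ x' && ~~ y -> (0 < a)%R by lia.
rewrite /move_plus /move_minus /positive_on; split.
  rewrite ifT; first by congr Some; apply/ffunP=> g; rewrite ffunE; apply: solve.
  apply/andP; split; apply/forallP=> g; apply/implyP=> xg; have [h1 h2 _ _] := excl g.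
    by apply: (pos _ _ _ _ _ _ (eq g)); rewrite ?xg ?h1.
  by apply: (pos _ _ _ _ _ _ (eq g)); rewrite ?xg ?orbT ?h2.
have eq' g : (phi g + (is_x i.+2 g)%:Z + (is_y i g)%:Z =
    phi' g + (is_x i g)%:Z + (is_y i.+1 g)%:Z)%R by [].
rewrite ifT; first by congr Some; apply/ffunP=> g; rewrite ffunE; apply: solve.
apply/andP; split; apply/forallP=> g; apply/implyP=> xg; have [_ _ h1 h2] := excl g.
  by apply: (pos _ _ _ _ _ _ (eq' g)); rewrite ?xg ?h1.
by apply: (pos _ _ _ _ _ _ (eq' g)); rewrite ?xg ?orbT ?h2.
Qed.

(** Without a conflict, maximality would put [r'] in [C]; being different from [r], it would lie in
    [C' :\ r']. *)
Lemma exists_conflict C C' (r r' : edge_seq n) : maximal_clique C -> maximal_clique C' ->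
  r \in C -> r' \in C' -> C :\ r = C' :\ r' -> C <> C' -> exists i, conflict_at i r r'.
Proof.
move=> maxC maxC' rC r'C' CC' neC; apply: contrapT => nc.
have CE := finset.setD1K rC; have C'E := finset.setD1K r'C'.
have neq : r' <> r by move=> eq; apply: neC; rewrite -CE -C'E CC' eq.
have r'C : val r' \in routes C.
  apply: (routes_maximal maxC) => [|s sC].
    by apply: (routes_walk maxC'); rewrite mem_routes.
  have [->|nsr] := eqVneq s (val r); first by move=> i cf; apply: nc; exists i.
  have : s \in routes (C' :\ r') by rewrite -CC' routes_setD1 nsr.
  rewrite routes_setD1 => /andP[_ sC']; apply: (routes_compatible maxC') sC' _.
  by rewrite mem_routes.
have : r' \in C :\ r by rewrite in_setD1 (introN eqP neq) -mem_routes.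
by rewrite CC' in_setD1 eqxx.
Qed.

End Walks.

Theorem theorem4 (R : realType) (n : nat) (hn : (3 <= n)%N)
  (C C' : {set edge_seq n})
  (hC : maximal_clique C) (hC' : maximal_clique C')
  (hadj : adjacent R C C') :
  int_flow (flow_of C) /\ int_flow (flow_of C') /\
  adjacent_flows (flow_of C) (flow_of C').
Proof.
have flC := int_flow_of hn hC; have flC' := int_flow_of hn hC'.
split=> //; split=> //; case: flC flC' => [C0 _] [C'0 _].
case: hadj => neS [F [[r rC FE] [r' r'C' F'E]]].
have neC : C <> C' by move=> eqC; apply: neS; rewrite eqC.
have walkD (X : {set edge_seq n}) s t : maximal_clique X -> t \in X :\ s -> is_route t.
  by case=> -[rX _] _; rewrite in_setD1 => /andP[_ /rX].
have CC' : C :\ r = C' :\ r'.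
  have eqS : simplex R (C :\ r) = simplex R (C' :\ r') by rewrite -FE.
  apply/eqP; rewrite finset.eqEsubset; apply/andP; split.
    by apply: (simplex_subset hn _ _ eqS) => t; apply: walkD.
  by apply: (simplex_subset hn _ _ (esym eqS)) => t; apply: walkD.
have [i0 c0] := exists_conflict hn hC hC' rC r'C' CC' neC.
have ex : exists i, `[< conflict_at i r r' >] by exists i0; apply/asboolP.
have ub i : `[< conflict_at i r r' >] -> i <= n.
  by move/asboolP=> [/andP[_ /ltnW]].
case: (ex_maxnP ex ub) => i /asboolP[inn [P [Q [P' [Q' [rE r'E]]]]]].
move=> /andP[Pi Qi] /andP[P'i Q'i] cr max_i.
have last j : i < j -> ~ conflict_at j r r'.
  by move=> ij /asboolP/max_i; rewrite leqNgt ij.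
have last' j : i < j -> ~ conflict_at j r' r.
  by move=> ij /conflict_sym; apply: last.
have i1 : 1 < i by case/andP: inn.
exists i; first by rewrite i1 /=; case/andP: inn => _; case: (n).
(* The order of the two prefixes decides which clique plays the first role, hence the direction of
   the move. *)
case/orP: cr => /andP[PP' QQ'].
  right; have := flip_flow hn hC' hC r'C' rC (esym CC') inn r'E rE P'i Q'i Pi Qi PP' QQ' last'.
  by move/(moves_of_flows hn i1 C'0 C0) => [].
left; have := flip_flow hn hC hC' rC r'C' CC' inn rE r'E Pi Qi P'i Q'i PP' QQ' last.
by move/(moves_of_flows hn i1 C0 C'0) => [].
Qed.
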